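(* Let $G = \mathrm{SO}_{10}(\mathbb{C})$ and let $H \subset G$ be the adjoint group of $\mathrm{SO}_5(\mathbb{C})$. Let $\theta$ be a Weyl involution of the maximal compact subgroup $K = \mathrm{SO}_{10}(\mathbb{R})$ of $G$. Then an antiholomorphic involution of $X = G/H$ cannot be $\theta$-equivariant; that is, there is no antiholomorphic involution $\mu : X \to X$ with $\mu(kx) = \theta(k)\mu(x)$ for all $x \in X$, $k \in K$.
   Context: The adjoint group $H$ of $\mathrm{SO}_5(\mathbb{C})$ is the image of $\mathrm{SO}_5(\mathbb{C})$ under its adjoint representation on the $10$-dimensional Lie algebra $\mathfrak{so}_5(\mathbb{C})$; it preserves the Killing form, and is regarded as a subgroup of $\mathrm{SO}_{10}(\mathbb{C})$ by identifying $\mathfrak{so}_5(\mathbb{C})$ with its Killing form with $\mathbb{C}^{10}$ with its standard nondegenerate symmetric bilinear form. $K$ acts on $X = G/H$ by left translations. A Weyl involution of a connected compact Lie group $K$ is an involutive automorphism $\theta : K \to K$ for which there exists a maximal torus $T \subset K$ with $\theta(t) = t^{-1}$ for all $t \in T$. An antiholomorphic involution of $X$ is an antiholomorphic map $\mu : X \to X$ with $\mu^2 = \mathrm{Id}$. *)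

(* Defs.v *)
From HB Require Import structures.
From mathcomp Require Import all_boot all_order all_algebra.
From mathcomp Require Import complex.
From mathcomp Require Import boolp classical_sets reals topology normedtype.
From mathcomp Require Import derive.

Set Implicit Arguments.
Unset Strict Implicit.
Unset Printing Implicit Defensive.

Import Order.TTheory GRing.Theory Num.Theory.
Import numFieldNormedType.Exports.

Local Open Scope classical_set_scope.
Local Open Scope ring_scope.

(* The ascription gives [R[i]] its modulus topology, for which
   [differentiable] on ['M[Cplx R]_n] means complex differentiable. *)
Definition Cplx (R : realType) : numClosedFieldType := R[i].

Section SpecialOrthogonal.
Variables (F : numFieldType) (n : nat).

Definition special_orthogonal (A : 'M[F]_n) : bool :=
  (A^T *m A == 1%:M) && (\det A == 1).

Record SO := MkSO { SO_val :> 'M[F]_n; SO_valP : special_orthogonal SO_val }.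

HB.instance Definition _ := [isSub for SO_val].
HB.instance Definition _ := [Choice of SO by <:].
HB.instance Definition _ := Topological.copy SO (initial_topology SO_val).

Lemma special_orthogonal1 : special_orthogonal 1%:M.
Proof. by rewrite /special_orthogonal trmx1 mulmx1 det1 !eqxx. Qed.

Lemma special_orthogonalM (A B : 'M[F]_n) :
  special_orthogonal A -> special_orthogonal B -> special_orthogonal (A *m B).
Proof.
move=> /andP[/eqP oA /eqP dA] /andP[/eqP oB /eqP dB].
by rewrite /special_orthogonal trmx_mul mulmxA -(mulmxA _ A^T) oA mulmx1 oB
  det_mulmx dA dB mulr1 !eqxx.
Qed.

Lemma special_orthogonalT (A : 'M[F]_n) :
  special_orthogonal A -> special_orthogonal A^T.
Proof.
move=> /andP[/eqP oA /eqP dA].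
by rewrite /special_orthogonal trmxK (mulmx1C oA) det_tr dA !eqxx.
Qed.

Definition SO_one : SO := MkSO special_orthogonal1.
Definition SO_mul (g h : SO) : SO :=
  MkSO (special_orthogonalM (SO_valP g) (SO_valP h)).
Definition SO_inv (g : SO) : SO := MkSO (special_orthogonalT (SO_valP g)).

Lemma SO_mulA : associative SO_mul.
Proof. by move=> x y z; apply/val_inj/mulmxA. Qed.
Lemma SO_mul1g : left_id SO_one SO_mul.
Proof. by move=> x; apply/val_inj/mul1mx. Qed.
Lemma SO_mulg1 : right_id SO_one SO_mul.
Proof. by move=> x; apply/val_inj/mulmx1. Qed.
Lemma SO_mulVg : left_inverse SO_one SO_inv SO_mul.
Proof. by move=> x; apply/val_inj/eqP; case/andP: (SO_valP x). Qed.
Lemma SO_mulgV : right_inverse SO_one SO_inv SO_mul.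
Proof. by move=> x; apply/val_inj/mulmx1C/eqP; case/andP: (SO_valP x). Qed.

HB.instance Definition _ :=
  isGroup.Build SO SO_mulA SO_mul1g SO_mulg1 SO_mulVg SO_mulgV.

End SpecialOrthogonal.

Section RealPoints.
Variables (R : realType) (n : nat).

Lemma complexify_subproof (k : SO R n) :
  special_orthogonal (map_mx (real_complex R) k : 'M[Cplx R]_n).
Proof.
case/andP: (SO_valP k) => /eqP ok /eqP dk; apply/andP; split; apply/eqP.
  by rewrite map_trmx -map_mxM ok map_mx1.
by rewrite det_map_mx dk rmorph1.
Qed.

Definition complexify (k : SO R n) : SO (Cplx R) n :=
  MkSO (complexify_subproof k).

End RealPoints.

Section LieAlgebra.
Variables (F : numFieldType) (n : nat).

Definition skew_defect (A : 'M[F]_n) : 'M[F]_n := A + A^T.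

Lemma skew_defect_linear : linear skew_defect.
Proof.
by move=> a A B; rewrite /skew_defect linearP /= scalerDr addrACA.
Qed.
HB.instance Definition _ :=
  GRing.isLinear.Build F 'M[F]_n 'M[F]_n _ skew_defect skew_defect_linear.

Definition so : vectType F := subvs_of (lker (linfun skew_defect)).

Lemma soP (A : 'M[F]_n) :
  reflect (A^T = - A) (A \in lker (linfun skew_defect)).
Proof.
rewrite memv_ker lfunE /= /skew_defect addrC addr_eq0; exact: eqP.
Qed.

Lemma tr_so (x : so) : (vsval x)^T = - vsval x.
Proof. exact/soP/subvsP. Qed.

Lemma Ad_subproof (a : SO F n) (x : so) :
  (a : 'M_n) *m vsval x *m (a^-1)%g \in lker (linfun skew_defect).
Proof. by apply/soP; rewrite !trmx_mul trmxK tr_so mulNmx mulmxN mulmxA. Qed.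

Definition Ad (a : SO F n) (x : so) : so := Subvs (Ad_subproof a x).

Lemma Ad1 (x : so) : Ad 1%g x = x.
Proof. by apply: val_inj; rewrite /= trmx1 mul1mx mulmx1. Qed.

Lemma AdM (a b : SO F n) (x : so) : Ad (a * b)%g x = Ad a (Ad b x).
Proof. by apply: val_inj; rewrite /= trmx_mul !mulmxA. Qed.

Lemma ad_subproof (x y : so) :
  vsval x *m vsval y - vsval y *m vsval x \in lker (linfun skew_defect).
Proof.
by apply/soP; rewrite linearB /= !trmx_mul !tr_so !mulNmx !mulmxN !opprK opprB.
Qed.

Definition ad (x y : so) : so := Subvs (ad_subproof x y).

End LieAlgebra.

Definition endo_trace (F : fieldType) (V : vectType F) (f : V -> V) : F :=
  \sum_(i < \dim {:V}) coord (vbasis {:V}) i (f (vbasis {:V})`_i).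

Definition killing (F : numFieldType) (n : nat) (x y : so F n) : F :=
  endo_trace (ad x \o ad y).

Definition killing_isometry (F : numFieldType) (n m : nat)
    (phi : so F n -> 'cV[F]_m) : Prop :=
  bijective phi /\
  forall x y, ((phi x)^T *m phi y) 0 0 = killing x y.

Section AdjointGroup.
Variables (F : numFieldType) (n m : nat) (phi : so F n -> 'cV[F]_m).

(* For [phi] a Killing isometry this is all of [phi Ad(SO_n) phi^-1]. *)
Definition adjoint_group : {pred SO F m} :=
  fun g => `[< exists a : SO F n,
    forall x, (g : 'M_m) *m phi x = phi (Ad a x) >].

Lemma adjoint_group_closed : group_closed adjoint_group.
Proof.
split=> [|g h /asboolP[a ga] /asboolP[b hb]]; apply/asboolP.
  by exists 1%g => x; rewrite mul1mx Ad1.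
exists (a * b^-1)%g => x; rewrite AdM -ga /= -mulmxA; congr (_ *m _).
rewrite -{1}(Ad1 x) -(mulgV b) AdM -hb mulmxA.
by have /= -> := congr1 (@SO_val _ _) (SO_mulVg h); rewrite mul1mx.
Qed.

End AdjointGroup.

Section CosetSpace.
Variables (G : groupType) (H : {pred G}) (Hgrp : group_closed H).

Definition coset_rel (g h : G) : bool := (g^-1 * h)%g \in H.

Lemma coset_rel_refl : reflexive coset_rel.
Proof. by move=> g; rewrite /coset_rel mulVg Hgrp.1. Qed.

Lemma coset_rel_sym : symmetric coset_rel.
Proof.
by move=> g h; apply/idP/idP => /(group_closedV Hgrp); rewrite invgM invgK.
Qed.

Lemma coset_rel_trans : transitive coset_rel.
Proof.
move=> h g k gh hk; rewrite /coset_rel -(mulgK h g^-1%g) -mulgA.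
exact: (group_closedM Hgrp).
Qed.

Definition coset_equiv : equiv_rel G :=
  EquivRel coset_rel coset_rel_refl coset_rel_sym coset_rel_trans.

Local Open Scope quotient_scope.

Definition coset_space : quotType G := {eq_quot coset_equiv}.

Definition translate (g : G) (x : coset_space) : coset_space :=
  \pi_coset_space (g * repr x)%g.

Lemma translate_pi (g h : G) :
  translate g (\pi_coset_space h) = \pi_coset_space (g * h)%g.
Proof.
apply/(@eqmodP _ coset_equiv); rewrite /= /coset_rel invgM -mulgA mulKg.
by apply/(@eqmodP _ coset_equiv); exact: reprK.
Qed.

End CosetSpace.

Section ComplexStructure.
Variables (R : realType) (n : nat).
Local Notation C := (Cplx R).

(* The structure sheaf of [SO_n(C)] as a complex submanifold of ['M[C]_n]. *)
Definition holomorphic_on_SO (U : set (SO C n)) (f : SO C n -> C) : Prop :=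
  open U /\
  forall g, U g -> exists (V : set 'M[C]_n) (f' : 'M[C]_n -> C),
    [/\ open V, V g, (forall A, V A -> differentiable f' A) &
        forall h, U h -> V h -> f h = f' h].

Variables (H : {pred SO C n}) (Hgrp : group_closed H).

(* The quotient complex structure, for which [SO_n(C) -> SO_n(C)/H] is a
   holomorphic submersion (H being a closed complex subgroup): a function on
   the quotient is holomorphic iff its pullback to [SO_n(C)] is. *)
Definition holomorphic_on_quotient
    (U : set (quotient_topology (coset_space Hgrp)))
    (f : quotient_topology (coset_space Hgrp) -> C) : Prop :=
  open U /\
  holomorphic_on_SO (\pi_(coset_space Hgrp)%qT @^-1` U)
                    (f \o \pi_(coset_space Hgrp)%qT).

(* A map is antiholomorphic when the conjugates of the pullbacks of local
   holomorphic functions are holomorphic. *)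
Definition antiholomorphic
    (mu : quotient_topology (coset_space Hgrp) ->
          quotient_topology (coset_space Hgrp)) : Prop :=
  continuous mu /\
  forall U f, holomorphic_on_quotient U f ->
    holomorphic_on_quotient (mu @^-1` U) (fun x => (f (mu x))^*).

End ComplexStructure.

Section WeylInvolution.
Variables (F : numFieldType) (n : nat).

(* A compact subgroup is automatically a Lie subgroup. *)
Definition torus (T : set (SO F n)) : Prop :=
  [/\ group_closed [in T],
      (forall s t, T s -> T t -> s * t = t * s)%g,
      compact T & connected T].

Definition maximal_torus (T : set (SO F n)) : Prop :=
  torus T /\ forall T', torus T' -> T `<=` T' -> T' = T.

(* Continuous automorphisms of a Lie group are smooth. *)
Definition Weyl_involution (theta : SO F n -> SO F n) : Prop :=
  [/\ continuous theta,
      {morph theta : g h / (g * h)%g},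
      involutive theta &
      exists2 T, maximal_torus T & forall t, T t -> theta t = (t^-1)%g].

End WeylInvolution.

(* Main.v *)
Require Import Defs.
From HB Require Import structures.
From mathcomp Require Import all_boot all_order all_fingroup all_algebra.
From mathcomp Require Import complex.
From mathcomp Require Import boolp classical_sets reals topology normedtype.
From mathcomp Require Import derive trigo.
From mathcomp Require Import ring.

Set Implicit Arguments.
Unset Strict Implicit.
Unset Printing Implicit Defensive.

Import Order.TTheory GRing.Theory Num.Theory.
Import numFieldNormedType.Exports.

Local Open Scope classical_set_scope.
Local Open Scope ring_scope.
Local Open Scope sesquilinear_scope.


(**
Write Lam for the second compound, which is the adjoint action of SO_5 in the
coordinates given by the entries above the diagonal. In these coordinates the
Killing form is -6 times the standard form ([killingE]), so that a Killing
isometry phi is a scalar multiple of a complex orthogonal matrix M, and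
H = M Lam(SO_5(C)) M^-1 ([killing_isometryE], [adjoint_groupP]).

A Weyl involution theta of SO_10(R) is k |-> s k s^-1 for some orthogonal s of
determinant -1 ([Weyl_reflection]). Indeed the maximal torus T that theta
inverts is conjugate to the standard one and every k is conjugate to an
element of T. A matrix and its inverse have the same trace in SO_10(R), so
theta preserves all traces; hence it extends to an algebra automorphism of the
whole matrix algebra and is conjugation by an orthogonal matrix s. The torus T
contains a complex structure J, and s J s^-1 = J^-1 = - J. Thus s is antilinear
on the five-dimensional complex space defined by J, and its real determinant is
(-1)^5 times a nonnegative number.

Suppose that mu is theta-equivariant. The compact group Lam(SO_5(R)), moved by
a suitable real orthogonal E, fixes a point b H of the quotient (the choice of E
makes det b equal to 1). Its image under theta then fixes mu(b H) = b' H. Since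
theta is conjugation by s, this means that N = M^-1 b'^-1 s E satisfies
N Lam(a) N^-1 \in Lam(SO_5(C)) for every real a in SO_5(R), while
det N = - (det M)^2 = -1.

Such an N has determinant 1 ([normalizer_det1]), because so_5 has no outer
automorphisms. Here is an argument that avoids the classification of
automorphisms. Conjugation by N sends the five matrices with a single
eigenvalue 1 and four eigenvalues -1, up to sign, to commuting symmetric
involutions of the same kind. These are simultaneously diagonal in an
orthonormal basis q, so Lam(q)^-1 N commutes with the diagonal sign matrices.
Their joint eigenspaces on so_5 are the lines spanned by
e_ij = E_ij - E_ji, so Lam(q)^-1 N = diag(nu_ij) with nu_ij = 1 or -1. As the
conjugates of Lam(SO_5(R)) act by Lie algebra automorphisms, comparing
[e_ij, e_jk] = e_ik with its image shows that nu_ij nu_jk nu_ik is invariant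
under even permutations of the five indices. Modulo 2 the edges of the complete
graph on five vertices are a sum of two pairs of triangles, each pair being
exchanged by an even permutation; therefore the product of all nu_ij is 1.
Finally det Lam(q) = (det q)^4 = 1.
*)

(** * Second compounds and coordinates on skew matrices of size five *)

Lemma tr_scalemx (F : pzRingType) m n a (A : 'M[F]_(m, n)) : (a *: A)^T = a *: A^T.
Proof. exact: linearZ. Qed.

Lemma third_index n (i j : 'I_n) : (2 < n)%N -> exists k : 'I_n, (k != i) && (k != j).
Proof.
move=> n3; have : (0 < #|(~: [set i; j])%SET|)%N.
  rewrite cardsCs finset.setCK card_ord subn_gt0 (leq_trans _ n3) // ltnS.
  by rewrite cards2; case: (i == j).
by case/card_gt0P => k; rewrite !inE negb_or => ?; exists k.
Qed.

(** The index p < 10 enumerates the pairs i < j below 5 in lexicographic order.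
The reductions modulo 5 and 10 are the identity on the tables; they only serve to
build the bounded indices in a way that computes. *)
Definition pair_fst (p : 'I_10) : 'I_5 :=
  Ordinal (ltn_pmod (nth 0 [:: 0; 0; 0; 0; 1; 1; 1; 2; 2; 3] p)%N (isT : 0 < 5)%N).
Definition pair_snd (p : 'I_10) : 'I_5 :=
  Ordinal (ltn_pmod (nth 0 [:: 1; 2; 3; 4; 2; 3; 4; 3; 4; 4] p)%N (isT : 0 < 5)%N).
Definition pair_index (i j : 'I_5) : 'I_10 :=
  Ordinal (ltn_pmod (nth 0 (nth [::] [:: [:: 0; 0; 1; 2; 3]; [:: 0; 0; 4; 5; 6];
    [:: 1; 4; 0; 7; 8]; [:: 2; 5; 7; 0; 9]; [:: 3; 6; 8; 9; 0]] i) j)%N (isT : 0 < 10)%N).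

Ltac ord_cases i := case: i => [[|[|[|[|[|[|[|[|[|[|?]]]]]]]]]] ?] //.

Lemma pair_lt p : (pair_fst p < pair_snd p)%N.
Proof. by ord_cases p. Qed.

Lemma pair_fstK p : pair_index (pair_fst p) (pair_snd p) = p.
Proof. by apply: val_inj; ord_cases p. Qed.

Lemma pair_indexC i j : pair_index i j = pair_index j i.
Proof. by apply: val_inj; ord_cases i; ord_cases j. Qed.

Lemma pair_indexK (i j : 'I_5) : (i < j)%N ->
  (pair_fst (pair_index i j) = i) * (pair_snd (pair_index i j) = j).
Proof. by move=> ij; split; apply: val_inj; move: ij; ord_cases i; ord_cases j. Qed.

Lemma pair_index_prod (F : comNzRingType) (g : 'I_5 -> F) (i j : 'I_5) : i != j ->
  g (pair_fst (pair_index i j)) * g (pair_snd (pair_index i j)) = g i * g j.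
Proof.
rewrite -val_eqE neq_ltn => /orP[] ij; first by rewrite !pair_indexK.
by rewrite pair_indexC !pair_indexK // mulrC.
Qed.

(** The sign matrices separate the basis vectors e_ij: a flip of an index that
belongs to one pair and not to the other acts on them with opposite signs. *)
Lemma pair_separated p r : p != r ->
  exists i, ((pair_fst p == i) || (pair_snd p == i)) &&
            ~~ ((pair_fst r == i) || (pair_snd r == i)).
Proof.
move=> pr.
have [r1|r1] := boolP ((pair_fst r == pair_fst p) || (pair_snd r == pair_fst p));
  last by exists (pair_fst p); rewrite eqxx r1.
have [r2|r2] := boolP ((pair_fst r == pair_snd p) || (pair_snd r == pair_snd p));
  last by exists (pair_snd p); rewrite eqxx orbT r2.
have := pair_lt p; have := pair_lt r.
case/orP: r1 => /eqP e1; case/orP: r2 => /eqP e2; rewrite -?e1 -?e2 ?ltnn //.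
  by case/eqP: pr; rewrite -[p]pair_fstK -[r]pair_fstK e1 e2.
by move=> h; rewrite ltnNge (ltnW h).
Qed.

Lemma sum_pairs (V : nmodType) (f : 'I_5 -> 'I_5 -> V) :
  \sum_i \sum_j f i j = \sum_i f i i +
    \sum_p (f (pair_fst p) (pair_snd p) + f (pair_snd p) (pair_fst p)).
Proof.
rewrite pair_big /= (bigID (fun x => x.1 == x.2)) /=; congr (_ + _).
  rewrite (reindex_onto (fun i => (i, i)) fst) /= => [|[i j] /= /eqP->//].
  by apply: eq_bigl => i; rewrite !eqxx.
rewrite (bigID (fun x : 'I_5 * 'I_5 => x.1 < x.2)%N) /= big_split /=; congr (_ + _).
  rewrite (reindex_onto (fun p => (pair_fst p, pair_snd p))
                        (fun x => pair_index x.1 x.2)) /=.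
    by apply: eq_bigl => p; rewrite pair_fstK pair_lt eqxx -val_eqE ltn_eqF ?pair_lt.
  by move=> [i j] /= /andP[_ ij]; rewrite !pair_indexK.
rewrite (reindex_onto (fun p => (pair_snd p, pair_fst p))
                      (fun x => pair_index x.1 x.2)) /=.
  apply: eq_bigl => p; rewrite pair_indexC pair_fstK -leqNgt (ltnW (pair_lt p)).
  by rewrite eqxx -val_eqE gtn_eqF ?pair_lt.
move=> [i j] /= /andP[]; rewrite -val_eqE /= => ne.
rewrite -leqNgt leq_eqVlt eq_sym (negPf ne) /= => ij.
by rewrite pair_indexC !pair_indexK.
Qed.

Section Compound.
Variable F : comNzRingType.

(** The matrix of 2 x 2 minors; by [skew_coord_conj] it is the matrix of
X |-> a X a^T on skew-symmetric matrices. *)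
Definition compound2 (a : 'M[F]_5) : 'M[F]_10 :=
  \matrix_(p, q) (a (pair_fst p) (pair_fst q) * a (pair_snd p) (pair_snd q)
                - a (pair_fst p) (pair_snd q) * a (pair_snd p) (pair_fst q)).

Definition skew_coord (X : 'M[F]_5) : 'cV[F]_10 :=
  \col_p X (pair_fst p) (pair_snd p).

Definition skew_of_coord (v : 'cV[F]_10) : 'M[F]_5 :=
  \matrix_(i, j) (if (i < j)%N then v (pair_index i j) 0
                  else if (j < i)%N then - v (pair_index i j) 0 else 0).

Lemma skew_of_coordK : cancel skew_of_coord skew_coord.
Proof. by move=> v; apply/colP => p; rewrite !mxE pair_lt pair_fstK. Qed.

Lemma skew_of_coord_tr v : (skew_of_coord v)^T = - skew_of_coord v.
Proof.
apply/matrixP => i j; rewrite !mxE pair_indexC.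
by case: ltngtP => // _; rewrite ?opprK ?oppr0.
Qed.

Lemma skew_of_coord_diag v i : skew_of_coord v i i = 0.
Proof. by rewrite mxE ltnn. Qed.

Lemma skew_coord_conj_aux (a X : 'M[F]_5) : X^T = - X -> (forall i, X i i = 0) ->
  skew_coord (a *m X *m a^T) = compound2 a *m skew_coord X.
Proof.
move=> sX dX; apply/colP => p; rewrite !mxE.
under eq_bigr => j _ do rewrite !mxE big_distrl /=.
rewrite sum_pairs big1 ?add0r => [|i _]; last by rewrite dX mulr0 mul0r.
apply: eq_bigr => q _; rewrite !mxE.
have -> : X (pair_snd q) (pair_fst q) = - X (pair_fst q) (pair_snd q).
  by rewrite -[X in LHS](trmxK X) sX !mxE.
ring.
Qed.

Lemma skew_coord_conj_of (a : 'M[F]_5) v :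
  skew_coord (a *m skew_of_coord v *m a^T) = compound2 a *m v.
Proof.
by rewrite skew_coord_conj_aux ?skew_of_coord_tr ?skew_of_coordK //;
  exact: skew_of_coord_diag.
Qed.

(** Used to turn statements about the action on skew matrices into identities
between compounds. *)
Lemma matrix_mulv_eq m n (A B : 'M[F]_(m, n)) :
  (forall v : 'cV_n, A *m v = B *m v) -> A = B.
Proof.
move=> AB; apply/matrixP => i j; have /colP/(_ i) := AB (delta_mx j 0).
by rewrite -!colE !mxE.
Qed.

Lemma compound2_1 : compound2 1%:M = 1%:M.
Proof.
apply: matrix_mulv_eq => v.
by rewrite -skew_coord_conj_of trmx1 mulmx1 !mul1mx skew_of_coordK.
Qed.

Lemma compound2_tr a : compound2 a^T = (compound2 a)^T.
Proof. by apply/matrixP => p q; rewrite !mxE; ring. Qed.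

Lemma compound2N a : compound2 (- a) = compound2 a.
Proof. by apply/matrixP => p q; rewrite !mxE; ring. Qed.

Lemma trace_compound2 a : \tr (compound2 a) *+ 2 = (\tr a) ^+ 2 - \tr (a *m a).
Proof.
have := sum_pairs (fun i j => a i i * a j j - a i j * a j i).
rewrite [X in _ = X + _]big1 ?add0r => [E|i _]; last exact: subrr.
rewrite expr2 /mxtrace mulr_sumr -sumrMnl.
transitivity (\sum_i \sum_j (a i i * a j j - a i j * a j i)).
  by rewrite E; apply: eq_bigr => p _; rewrite !mxE; ring.
rewrite -sumrB; apply: eq_bigr => i _.
rewrite sumrB big_distrl /= !mxE; congr (_ - _).
by apply: eq_bigr => j _; rewrite mulrC.
Qed.
End Compound.

Lemma compound2_map (F F' : comNzRingType) (f : {rmorphism F -> F'}) (a : 'M[F]_5) :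
  compound2 (map_mx f a) = map_mx f (compound2 a).
Proof. by apply/matrixP => p q; rewrite !mxE rmorphB !rmorphM. Qed.

Section CompoundNum.
Variable F : numFieldType.

Lemma skew_diag0 n (X : 'M[F]_n) i : X^T = - X -> X i i = 0.
Proof.
move=> /matrixP/(_ i i); rewrite !mxE => /eqP; rewrite -addr_eq0 -mulr2n.
by rewrite mulrn_eq0 => /eqP.
Qed.

Lemma skew_coordK (X : 'M[F]_5) : X^T = - X -> skew_of_coord (skew_coord X) = X.
Proof.
move=> sX; apply/matrixP => i j; rewrite !mxE.
case: ltngtP => [ij|ij|/val_inj->]; last by rewrite skew_diag0.
  by rewrite !pair_indexK.
by rewrite pair_indexC !pair_indexK // -[X in RHS](trmxK X) sX !mxE.
Qed.

Lemma skew_coord_conj (a X : 'M[F]_5) : X^T = - X ->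
  skew_coord (a *m X *m a^T) = compound2 a *m skew_coord X.
Proof. by move=> sX; rewrite -skew_coord_conj_of skew_coordK. Qed.

Lemma skew_conj_tr (a X : 'M[F]_5) : X^T = - X ->
  (a *m X *m a^T)^T = - (a *m X *m a^T).
Proof. by move=> sX; rewrite !trmx_mul trmxK sX mulNmx mulmxN mulmxA. Qed.

(** The Cauchy-Binet identity, obtained here by composing two conjugations. *)
Lemma compound2M (a b : 'M[F]_5) : compound2 (a *m b) = compound2 a *m compound2 b.
Proof.
apply: matrix_mulv_eq => v; rewrite -mulmxA -!skew_coord_conj_of.
rewrite skew_coordK ?skew_conj_tr ?skew_of_coord_tr //.
by rewrite trmx_mul !mulmxA.
Qed.

End CompoundNum.

(** For triangular [a] the compound is triangular too, since the lexicographic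
order on pairs refines the componentwise one; each diagonal entry of [a] occurs
in four of the ten diagonal products. *)
Lemma det_compound2_trig (F : numFieldType) (a : 'M[F]_5) :
  is_trig_mx a -> \det (compound2 a) = \det a ^+ 4.
Proof.
move=> /is_trig_mxP ta.
rewrite det_trig; last first.
  apply/is_trig_mxP => p q pq; rewrite !mxE.
  have [h1|h1] := ltnP (pair_fst p) (pair_fst q).
    rewrite ta // mul0r sub0r ta ?mul0r ?oppr0 //.
    exact: ltn_trans h1 (pair_lt q).
  have h2 : (pair_snd p < pair_snd q)%N by move: pq h1; ord_cases p; ord_cases q.
  rewrite (ta (pair_snd p)) // mulr0 sub0r ta ?mul0r ?oppr0 //.
  exact: ltn_trans (pair_lt p) h2.
rewrite det_trig; last exact/is_trig_mxP.
have -> : \prod_i compound2 a i i =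
    \prod_p (a (pair_fst p) (pair_fst p) * a (pair_snd p) (pair_snd p)).
  by apply: eq_bigr => p _; rewrite mxE (ta (pair_fst p) (pair_snd p)) ?pair_lt // mul0r subr0.
pose d k := a (inord k) (inord k).
have dE (i : 'I_5) : a i i = d i by rewrite /d inord_val.
under eq_bigr do rewrite !dE.
under [in RHS]eq_bigr do rewrite dE.
rewrite !big_ord_recl !big_ord0 /=; ring.
Qed.

(** Both sides are invariant under conjugation, so it is enough to look at a
Schur triangularization. *)
Lemma det_compound2 (C : numClosedFieldType) (a : 'M[C]_5) :
  \det (compound2 a) = \det a ^+ 4.
Proof.
have [P Pu tP] := Schur a (isT : 0 < 5)%N.
have {}tP : is_trig_mx (conjmx P a) := tP.
have Punit := unitarymx_unit Pu.
have aE : a = invmx P *m conjmx P a *m P.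
  by rewrite conjumx // -!mulmxA mulVmx // mulmx1 mulKmx.
have dP : \det (compound2 (invmx P)) * \det (compound2 P) = 1.
  by rewrite -det_mulmx -compound2M mulVmx // compound2_1 det1.
move: (conjmx P a) tP aE => t tP aE.
rewrite [in LHS]aE !compound2M !det_mulmx mulrAC dP mul1r.
rewrite (det_compound2_trig tP) [in RHS]aE !det_mulmx mulrAC -det_mulmx mulVmx //.
by rewrite det1 mul1r.
Qed.

(** * Orthogonal maps normalizing the adjoint group *)

Section ElementarySkew.
Variable F : numFieldType.

Definition skew_unit n (i j : 'I_n) : 'M[F]_n := delta_mx i j - delta_mx j i.

Lemma tr_skew_unit n (i j : 'I_n) : (skew_unit i j)^T = - skew_unit i j.
Proof. by rewrite /skew_unit linearB /= !trmx_delta opprB. Qed.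

(** The only structure constants of the Lie algebra that are needed below. *)
Lemma skew_unit_bracket n (i j k : 'I_n) : i != j -> j != k -> i != k ->
  skew_unit i j *m skew_unit j k - skew_unit j k *m skew_unit i j = skew_unit i k.
Proof.
move=> ij jk ik; rewrite /skew_unit !mulmxBl !mulmxBr !mul_delta_mx_cond.
rewrite !eqxx ![k == _]eq_sym [j == i]eq_sym (negPf ij) (negPf ik) (negPf jk).
by rewrite !mulr0n !mulr1n ?subr0 ?sub0r ?add0r ?addr0 ?opprK.
Qed.

Lemma mulmx_perm_delta n (s : 'S_n) (i j : 'I_n) :
  perm_mx s^-1 *m delta_mx i j *m (perm_mx s^-1)^T = delta_mx (s i) (s j) :> 'M[F]_n.
Proof.
rewrite tr_perm_mx -row_permE -col_permE; apply/matrixP => k l; rewrite !mxE.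
by rewrite !(canF_eq (permKV s)).
Qed.

Lemma skew_unit_perm n (s : 'S_n) (i j : 'I_n) :
  perm_mx s^-1 *m skew_unit i j *m (perm_mx s^-1)^T = skew_unit (s i) (s j).
Proof. by rewrite mulmxBr mulmxBl !mulmx_perm_delta. Qed.

(** Comparing the entries of [M e_ij] and [e_ij M] in column j forces [M] to be
diagonal with equal entries; a third index is needed to reach the entry (k, i). *)
Lemma comm_skew_scalar n (M : 'M[F]_n) : (2 < n)%N ->
  (forall X : 'M[F]_n, X^T = - X -> M *m X = X *m M) -> is_scalar_mx M.
Proof.
case: n M => [//|[//|[//|n]]] M _ cM.
have cE i j k l : (M *m skew_unit i j) k l = (skew_unit i j *m M) k l.
  by rewrite cM ?tr_skew_unit.
have mE i j k : i != j -> (M *m skew_unit i j) k j = M k i.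
  move=> ij; rewrite mulmxBr mxE [X in _ + X]mxE !mxE (bigD1 i) //= big1.
    rewrite !mxE !eqxx mulr1 addr0 big1 ?subr0 // => l _.
    by rewrite !mxE ![j == _]eq_sym (negPf ij) andbF mulr0.
  by move=> l li; rewrite mxE (negPf li) mulr0.
have eE i j k : i != j -> (skew_unit i j *m M) k j = (k == i)%:R * M j j - (k == j)%:R * M i j.
  move=> ij; rewrite mulmxBl mxE [X in _ + X]mxE !mxE; congr (_ - _).
    by rewrite (bigD1 j) //= big1 ?mxE ?eqxx ?andbT ?addr0 // => l lj;
      rewrite mxE (negPf lj) andbF mul0r.
  by rewrite (bigD1 i) //= big1 ?mxE ?eqxx ?andbT ?addr0 // => l lj;
      rewrite mxE (negPf lj) andbF mul0r.
apply/is_scalar_mxP; exists (M ord0 ord0); apply/matrixP => k i; rewrite !mxE.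
have [->|ki] := eqVneq k i.
  have [->//|i0] := eqVneq i ord0.
  by rewrite -(mE i ord0) // cE eE // eqxx (negPf i0) mul1r mul0r subr0.
have [j /andP[ji jk]] := third_index i k isT.
have ij : i != j by rewrite eq_sym.
rewrite -(mE i j) // cE eE // (negPf ki) mulr0n.
by rewrite [k == j]eq_sym (negPf jk) !mul0r subr0.
Qed.

(** The adjoint action of SO_5 is faithful: its kernel consists of scalar matrices
c with c^2 = 1 and c^5 = 1. *)
Lemma compound2_eq1 (a : 'M[F]_5) :
  a^T *m a = 1%:M -> \det a = 1 -> compound2 a = 1%:M -> a = 1%:M.
Proof.
move=> oa da La.
have /is_scalar_mxP[c ac] : is_scalar_mx a.
  apply: comm_skew_scalar => // X sX.
  have E : a *m X *m a^T = X.
    by rewrite -[LHS]skew_coordK ?skew_conj_tr // skew_coord_conj // La mul1mx skew_coordK.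
  by rewrite -[in RHS]E -[RHS]mulmxA oa mulmx1.
move: oa da; rewrite ac tr_scalar_mx -scalar_mxM det_scalar.
move=> /(congr1 (fun A : 'M_5 => A 0 0)); rewrite !mxE eqxx !mulr1n => cc.
by rewrite !exprS expr0 mulr1 cc mulr1 cc mulr1 => ->.
Qed.

End ElementarySkew.

Section Projectors.
Variable C : numClosedFieldType.

(** The rank factorization P = c w of an idempotent has w c = 1, so that its
trace is its rank. *)
Lemma idempotent_factor (F : fieldType) n (P : 'M[F]_n) : P *m P = P ->
  exists r (c : 'M_(n, r)) (w : 'M_(r, n)), P = c *m w /\ w *m c = 1%:M.
Proof.
move=> PP; exists (\rank P), (col_base P), (row_base P); split.
  by rewrite mulmx_base.
apply: (row_full_inj (col_base_full P)); rewrite mulmx1 mulmxA.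
by apply: (row_free_inj (row_base_free P)); rewrite -mulmxA !mulmx_base.
Qed.

(** In a factorization P = c w through a line, symmetry makes w proportional to c^T
with a nonzero factor, and a square root of that factor normalizes c. *)
Lemma rank_one_projector n (P : 'M[C]_n) :
  P^T = P -> P *m P = P -> \tr P = 1 ->
  exists2 v : 'cV[C]_n, v^T *m v = 1%:M & P = v *m v^T.
Proof.
move=> sP /idempotent_factor[r [c [w [PE wc]]]] trP.
have r1 : r = 1%N.
  apply/eqP; rewrite -(eqr_nat C) -[r%:R]/((1 : C) *+ r) -(mxtrace1 C r) -wc mxtrace_mulC -PE.
  exact/eqP.
subst r; pose s := (c^T *m c) 0 0.
have cE : c = s *: w^T.
  rewrite -[LHS]mulmx1 -wc mulmxA -PE -sP PE trmx_mul -mulmxA.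
  by rewrite [c^T *m c]mx11_scalar -/s mul_mx_scalar.
have s0 : s != 0.
  apply: contra_neq (oner_neq0 C) => s0; move: wc; rewrite cE s0 scale0r mulmx0.
  by move/matrixP/(_ 0 0); rewrite !mxE.
have sK : sqrtC s * sqrtC s = s by rewrite -expr2 sqrtCK.
exists ((sqrtC s)^-1 *: c).
  rewrite tr_scalemx -scalemxAl -scalemxAr scalerA [c^T *m c]mx11_scalar -/s.
  by rewrite -invfM sK scale_scalar_mx mulVf.
rewrite tr_scalemx -scalemxAl -scalemxAr scalerA -invfM sK {2}cE.
by rewrite tr_scalemx trmxK -scalemxAr scalerA mulVf // scale1r.
Qed.

(** Two commuting symmetric projectors of rank one are equal or have orthogonal
images, so that unit vectors spanning the images form an orthonormal basis for the
bilinear form. *)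
Lemma codiagonal_projectors n (P : 'I_n -> 'M[C]_n) :
  (forall i, [/\ (P i)^T = P i, P i *m P i = P i & \tr (P i) = 1]) ->
  (forall i j, P i *m P j = P j *m P i) -> injective P ->
  exists2 q : 'M[C]_n, q^T *m q = 1%:M & forall i, P i = q *m delta_mx i i *m q^T.
Proof.
move=> hP cP iP.
have /fin_all_exists[v hv] (i : 'I_n) : exists v : 'cV[C]_n, v^T *m v = 1%:M /\ P i = v *m v^T.
  by have [? ? /rank_one_projector[]// v] := hP i; exists v.
pose q : 'M[C]_n := \matrix_(k, i) v i k 0.
have qE i : q *m delta_mx i (0 : 'I_1) = v i.
  by rewrite -colE; apply/colP => k; rewrite !mxE.
have dot i j : i != j -> (v i)^T *m v j = 0.
  move=> ij; rewrite [LHS]mx11_scalar; set g := fun_of_matrix _ _ _.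
  have gE : (v i)^T *m v j = g%:M by rewrite [LHS]mx11_scalar.
  have gE' : (v j)^T *m v i = g%:M.
    by rewrite -[LHS]trmxK trmx_mul trmxK gE tr_scalar_mx.
  have [->|g0] := eqVneq g 0; first by rewrite raddf0.
  case/eqP: ij; apply: iP.
  have vv : v i *m (v j)^T = v j *m (v i)^T.
    apply: (scalerI g0); have := cP i j; rewrite (hv i).2 (hv j).2.
    rewrite -mulmxA (mulmxA (v i)^T) gE mul_scalar_mx -scalemxAr => ->.
    by rewrite -mulmxA (mulmxA (v j)^T) gE' mul_scalar_mx -scalemxAr.
  have vE : v i = g *: v j.
    by rewrite -[LHS]mulmx1 -(hv j).1 mulmxA vv -mulmxA gE mul_mx_scalar.
  have gg : g * g = 1.
    have := (hv i).1; rewrite vE tr_scalemx -scalemxAl -scalemxAr scalerA (hv j).1.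
    by move/matrixP/(_ 0 0); rewrite !mxE mulr1.
  by rewrite (hv i).2 (hv j).2 vE tr_scalemx -scalemxAl -scalemxAr scalerA gg scale1r.
exists q => [|i]; last first.
  have qE' : delta_mx (0 : 'I_1) i *m q^T = (v i)^T.
    by rewrite -qE trmx_mul trmx_delta.
  by rewrite -(mul_delta_mx (0 : 'I_1)) mulmxA -mulmxA qE' qE (hv i).2.
apply/matrixP => i j; have -> : (q^T *m q) i j = ((v i)^T *m v j) 0 0.
  by rewrite !mxE; apply: eq_bigr => k _; rewrite !mxE.
have [->|ij] := eqVneq i j; first by rewrite (hv j).1 !mxE !eqxx.
by rewrite dot // !mxE (negPf ij).
Qed.

End Projectors.

Section Flips.
Variable F : comNzRingType.

(** The reflection in the hyperplane orthogonal to the basis vector [a]. *)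
Definition flip_mx n (a : 'I_n) : 'M[F]_n := 1%:M - 2%:R *: delta_mx a a.

Lemma flip_mx_diag n (a : 'I_n) : flip_mx a = diag_mx (\row_j (-1) ^+ (j == a)).
Proof.
apply/matrixP => i j; rewrite !mxE.
have [<-|ij] := eqVneq i j; last first.
  have -> : (i == a) && (j == a) = false.
    by apply: contra_neqF ij => /andP[/eqP-> /eqP->].
  by rewrite mulr0 !mulr0n subr0.
have [_|_] := eqVneq i a; rewrite /= !mulr1n; last by rewrite mulr0 subr0.
by rewrite mulr1 -[2%:R]/(1 + 1) opprD addrA subrr sub0r.
Qed.

Lemma flip_mx_tr n (a : 'I_n) : (flip_mx a)^T = flip_mx a.
Proof. by rewrite flip_mx_diag tr_diag_mx. Qed.

Lemma flip_mx_sqr n (a : 'I_n) : flip_mx a *m flip_mx a = 1%:M.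
Proof.
rewrite flip_mx_diag mulmx_diag -diag_const_mx; congr diag_mx; apply/rowP => j.
by rewrite !mxE -expr2 sqrr_sign.
Qed.

Lemma flip_mx_orthogonal n (a : 'I_n) : (flip_mx a)^T *m flip_mx a = 1%:M.
Proof. by rewrite flip_mx_tr flip_mx_sqr. Qed.

Lemma flip_mxC n (a b : 'I_n) : flip_mx a *m flip_mx b = flip_mx b *m flip_mx a.
Proof. by rewrite !flip_mx_diag diag_mxC. Qed.

Lemma det_flip_mx n (a : 'I_n) : \det (flip_mx a) = -1.
Proof.
rewrite flip_mx_diag det_diag (bigD1 a) //= mxE eqxx big1 ?mulr1 // => j ja.
by rewrite mxE (negPf ja).
Qed.

Lemma tr_flip_mx n (a : 'I_n) : \tr (flip_mx a) = n%:R - 2%:R.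
Proof.
rewrite linearB /= mxtrace1 mxtraceZ -(mul_delta_mx (0 : 'I_1)) mxtrace_mulC.
by rewrite mul_delta_mx /mxtrace big_ord1 mxE eqxx mulr1.
Qed.

Lemma compound2_diag (d : 'rV[F]_5) :
  compound2 (diag_mx d) = diag_mx (\row_p (d 0 (pair_fst p) * d 0 (pair_snd p))).
Proof.
apply/matrixP => p q; rewrite !mxE; have [->|pq] := eqVneq p q.
  have := pair_lt q; rewrite ltn_neqAle => /andP[/negPf ne _].
  by rewrite !eqxx !mulr1n -!val_eqE /= ne mul0r subr0.
have A : (pair_fst p == pair_fst q) && (pair_snd p == pair_snd q) = false.
  apply: contra_neqF pq => /andP[/eqP e1 /eqP e2].
  by rewrite -[p]pair_fstK -[q]pair_fstK e1 e2.
have B : (pair_fst p == pair_snd q) && (pair_snd p == pair_fst q) = false.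
  apply/negP => /andP[/eqP e1 /eqP e2].
  by have := pair_lt p; rewrite e1 e2 ltnNge (ltnW (pair_lt q)).
move: A B; case: (pair_fst p == pair_fst q); case: (pair_snd p == pair_snd q);
  case: (pair_fst p == pair_snd q); case: (pair_snd p == pair_fst q) => //= _ _;
  by rewrite ?mulr0n ?mulr0 ?mul0r subr0.
Qed.

Lemma compound2_flip (i : 'I_5) : compound2 (flip_mx i) =
  diag_mx (\row_p (if (pair_fst p == i) || (pair_snd p == i) then -1 else 1)).
Proof.
rewrite flip_mx_diag compound2_diag; congr diag_mx; apply/rowP => p.
rewrite !mxE -signr_addb.
have := pair_lt p; rewrite ltn_neqAle val_eqE => /andP[/negPf ne _].
have [pi|_] := eqVneq (pair_fst p) i; last by case: eqVneq.
by rewrite eq_sym -pi ne.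
Qed.

Lemma compound2_flip_inj : 2%:R != 0 :> F ->
  injective (fun i : 'I_5 => compound2 (flip_mx i)).
Proof.
move=> two0 i j /matrixP E; apply/eqP; apply: contraT => ij.
have [k /andP[ki kj]] := third_index i j isT.
have := E (pair_index i k) (pair_index i k).
rewrite !flip_mx_diag !compound2_diag !mxE !eqxx !mulr1n.
rewrite (pair_index_prod (fun l => (-1) ^+ (l == i))) 1?eq_sym //.
rewrite (pair_index_prod (fun l => (-1) ^+ (l == j))) 1?eq_sym //.
rewrite eqxx (negPf ki) (negPf ij) (negPf kj) /= !mulr1 => /eqP.
by rewrite eq_sym -addr_eq0 (negPf two0).
Qed.

End Flips.

(** The form in which invariance of the triangle products is used: (a, a'), (b, b')
and (c, c') are the signs of the three edges and of their images. *)
Lemma sign_triangle (F : comNzRingType) (a b c a' b' c' : F) :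
  a * a = 1 -> b * b = 1 -> c' * c' = 1 ->
  a * a' * (b * b') = c * c' -> a * b * c = a' * b' * c'.
Proof.
move=> aa bb cc E.
transitivity (a * b * (c * c') * c'); first by rewrite -[RHS]mulrA -[c * c' * c']mulrA cc mulr1.
rewrite -E; transitivity ((a * a) * (b * b) * (a' * b' * c')); first by ring.
by rewrite aa bb !mul1r.
Qed.

Section Normalizer.
Variables (R : numFieldType) (C : numClosedFieldType) (f : {rmorphism R -> C}).

(** The involutions [b i] below are the images of the flips, normalized to have
trace -3 so that (b + 1) / 2 has trace 1 and projects onto a line. An orthogonal
q that diagonalizes these projectors makes Lam(q)^-1 N commute with the
compounds of all flips, whose joint eigenspaces are lines. *)
Lemma normalizer_diagonalizes (N : 'M[C]_10) :
  N *m N^T = 1%:M ->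
  (forall a : 'M[R]_5, a^T *m a = 1%:M -> \det a = 1 ->
   exists2 a' : 'M[C]_5, a'^T *m a' = 1%:M &
     N *m compound2 (map_mx f a) = compound2 a' *m N) ->
  exists2 q : 'M[C]_5, q^T *m q = 1%:M &
    exists nu : 'rV_10, N = compound2 q *m diag_mx nu.
Proof.
move=> NN hN.
have NN' : N^T *m N = 1%:M := mulmx1C NN.
have fs (i : 'I_5) : map_mx f (flip_mx R i) = flip_mx C i.
  rewrite !flip_mx_diag map_diag_mx; congr diag_mx; apply/rowP => j.
  by rewrite !mxE rmorph_sign.
have conjM (X Y : 'M[C]_10) : N *m X *m N^T *m (N *m Y *m N^T) = N *m (X *m Y) *m N^T.
  by rewrite -!mulmxA (mulmxA N^T N) NN' mul1mx.
have /fin_all_exists[b hb] (i : 'I_5) : exists b : 'M[C]_5,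
    [/\ b^T *m b = 1%:M, compound2 b = N *m compound2 (flip_mx C i) *m N^T,
        b *m b = 1%:M & \tr b = - 3%:R].
  have [||a oa aE] := hN (- flip_mx R i).
  - by rewrite [(- _)^T]linearN /= mulNmx mulmxN opprK flip_mx_orthogonal.
  - by rewrite -scaleN1r detZ det_flip_mx -signr_odd expr1 mulrNN mulr1.
  rewrite map_mxN fs compound2N in aE.
  have LE : compound2 a = N *m compound2 (flip_mx C i) *m N^T.
    by rewrite aE -mulmxA NN mulmx1.
  have aa : a *m a = 1%:M.
    apply: compound2_eq1.
    - by rewrite trmx_mul -mulmxA (mulmxA a^T a) oa mul1mx.
    - by rewrite det_mulmx -{1}det_tr -det_mulmx oa det1.
    by rewrite compound2M LE conjM -compound2M flip_mx_sqr compound2_1 mulmx1.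
  (* The trace of the compound determines (tr a)^2 once a^2 = 1. *)
  have tr9 : \tr a ^+ 2 = 3%:R ^+ 2.
    apply: (addIr (- \tr (a *m a))); rewrite -trace_compound2 LE mxtrace_mulC mulmxA.
    rewrite NN' mul1mx trace_compound2 flip_mx_sqr aa tr_flip_mx; congr (_ - _).
    by rewrite -natrB.
  move/eqP: tr9; rewrite eqf_sqr => /orP[] /eqP tra; last by exists a.
  exists (- a); split; last by rewrite linearN /= tra.
  - by rewrite [(- a)^T]linearN /= mulNmx mulmxN opprK.
  - by rewrite compound2N.
  - by rewrite mulNmx mulmxN opprK.
have ob i : (b i)^T *m b i = 1%:M by case: (hb i).
have bE i : compound2 (b i) = N *m compound2 (flip_mx C i) *m N^T by case: (hb i).
have bb i : b i *m b i = 1%:M by case: (hb i).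
have sb i : (b i)^T = b i.
  by rewrite -[LHS]mulmx1 -(bb i) mulmxA ob mul1mx.
have cb i j : b i *m b j = b j *m b i.
  have E : b i *m b j *m (b i *m b j) = 1%:M.
    apply: compound2_eq1.
    - rewrite trmx_mul !trmx_mul !sb.
      rewrite -!mulmxA (mulmxA (b i) (b i)) bb mul1mx (mulmxA (b j) (b j)) bb mul1mx.
      by rewrite (mulmxA (b i) (b i)) bb mul1mx bb.
    - by rewrite !det_mulmx mulrACA -!det_mulmx !bb mulmx1 det1.
    rewrite !compound2M !bE !conjM -!compound2M.
    rewrite {1}[flip_mx C i *m flip_mx C j]flip_mxC mulmxA -(mulmxA (flip_mx C j)).
    by rewrite flip_mx_sqr mulmx1 flip_mx_sqr compound2_1 mulmx1.
  have E' : b i *m b j *m (b j *m b i) = 1%:M.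
    by rewrite mulmxA -(mulmxA (b i)) bb mulmx1 bb.
  by rewrite -[LHS]mulmx1 -E' mulmxA E mul1mx.
pose P i := 2%:R^-1 *: (b i + 1%:M).
have two0 : 2%:R != 0 :> C by rewrite pnatr_eq0.
have bP i : b i = 2%:R *: P i - 1%:M by rewrite scalerA divff // scale1r addrK.
have [||| q oq qE] := @codiagonal_projectors C 5 P.
- move=> i; split.
  + by rewrite tr_scalemx linearD /= sb trmx1.
  + have E : (b i + 1%:M) *m (b i + 1%:M) = 2%:R *: (b i + 1%:M).
      rewrite mulmxDl !mulmxDr !mulmx1 mul1mx bb [1%:M + b i]addrC.
      by rewrite [RHS]scaler_nat mulr2n.
    by rewrite -scalemxAl -scalemxAr E (scalerA 2%:R^-1 2%:R) mulVf // scale1r.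
  + rewrite linearZ linearD /= mxtrace1; have [_ _ _ ->] := hb i.
    by rewrite /=; field.
- move=> i j; rewrite -!scalemxAl -!scalemxAr !mulmxDl !mulmxDr !mulmx1 !mul1mx cb.
  by rewrite -!addrA [b i + _]addrCA.
- move=> i j Pij; apply/eqP/negPn/negP => ij.
  have bij : compound2 (b i) = compound2 (b j) by rewrite !bP Pij.
  have sij : compound2 (flip_mx C i) = compound2 (flip_mx C j).
    have E k : N^T *m compound2 (b k) *m N = compound2 (flip_mx C k).
      by rewrite bE -!mulmxA NN' mulmx1 mulmxA NN' mul1mx.
    by rewrite -!E bij.
  by move/(compound2_flip_inj two0): sij ij => ->; rewrite eqxx.
exists q => //.
have bq i : b i = - (q *m flip_mx C i *m q^T).
  rewrite bP qE /flip_mx mulmxBr mulmxBl mulmx1 (mulmx1C oq) opprB.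
  by rewrite -scalemxAr -scalemxAl.
pose M := compound2 q^T *m N.
have cM i : M *m compound2 (flip_mx C i) = compound2 (flip_mx C i) *m M.
  rewrite /M -mulmxA.
  have -> : N *m compound2 (flip_mx C i) = compound2 (b i) *m N.
    by rewrite bE -!mulmxA NN' mulmx1.
  by rewrite mulmxA -compound2M bq mulmxN compound2N !mulmxA oq mul1mx compound2M.
have dM p r : p != r -> M p r = 0.
  move/pair_separated=> [i /andP[ip ir]].
  have /matrixP/(_ p r) := cM i.
  rewrite compound2_flip mul_mx_diag mul_diag_mx !mxE ip (negPf ir) mulN1r mulr1.
  by move/eqP; rewrite -addr_eq0 -mulr2n mulrn_eq0 => /eqP.
exists (\row_p M p p).
have <- : M = diag_mx (\row_p M p p).
  apply/matrixP => p r; rewrite [RHS]mxE [X in _ = X *+ _]mxE.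
  by have [->//|pr] := eqVneq p r; rewrite dM.
by rewrite mulmxA -compound2M (mulmx1C oq) compound2_1 mul1mx.
Qed.

(** It remains to see that the signs [nu] multiply to 1. With indices 0, ..., 4,
the edges of the triangles 012, 034, 123, 124 sum up modulo 2 to the complete
graph. The even permutations (13)(24) and (34)(12) exchange the first two and
the last two triangles, so that the four triangle products have product 1. *)
Lemma normalizer_det1 (N : 'M[C]_10) :
  N *m N^T = 1%:M ->
  (forall a : 'M[R]_5, a^T *m a = 1%:M -> \det a = 1 ->
   exists2 a' : 'M[C]_5, a'^T *m a' = 1%:M &
     N *m compound2 (map_mx f a) = compound2 a' *m N) ->
  \det N = 1.
Proof.
move=> NN hN.
have [q oq [nu NE]] := normalizer_diagonalizes NN hN.
have qq := mulmx1C oq.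
have detq : \det (compound2 q) = 1.
  have dq : \det q ^+ 2 = 1 by rewrite expr2 -{1}det_tr -det_mulmx oq det1.
  by rewrite det_compound2 -[4%N]/(2 * 2)%N exprM dq expr1n.
pose D := diag_mx nu.
have DD : D *m D = 1%:M.
  have := mulmx1C NN; rewrite NE trmx_mul -compound2_tr mulmxA -(mulmxA _^T).
  by rewrite -compound2M oq compound2_1 mulmx1 tr_diag_mx.
have nu2 p : nu 0 p * nu 0 p = 1.
  by have /matrixP/(_ p p) := DD; rewrite /D mulmx_diag !mxE eqxx mulr1n.
have hD (s : 'S_5) : ~~ odd_perm s -> exists2 a : 'M[C]_5, a^T *m a = 1%:M &
    D *m compound2 (perm_mx s^-1) *m D = compound2 a.
  move=> es; have [||a oa aE] := hN (perm_mx s^-1).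
  - by rewrite tr_perm_mx -perm_mxM mulVg perm_mx1.
  - by rewrite det_perm odd_permV (negPf es).
  exists (q^T *m a *m q).
    rewrite !trmx_mul trmxK -!mulmxA (mulmxA q q^T) qq mul1mx (mulmxA a^T) oa mul1mx.
    by rewrite oq.
  move: aE; rewrite map_perm_mx NE -/D => aE.
  transitivity (compound2 q^T *m (compound2 q *m D *m compound2 (perm_mx s^-1)) *m D).
    by rewrite !mulmxA -compound2M oq compound2_1 mul1mx.
  by rewrite aE !compound2M -!mulmxA DD mulmx1.
pose nu' i j := nu 0 (pair_index i j).
have De i j : D *m skew_coord (skew_unit C i j) = nu' i j *: skew_coord (skew_unit C i j).
  apply/colP => p; rewrite mul_diag_mx !mxE /nu'.
  have [/andP[/eqP<- /eqP<-]|n1] := boolP ((pair_fst p == i) && (pair_snd p == j)).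
    by rewrite pair_fstK.
  have [/andP[/eqP<- /eqP<-]|n2] := boolP ((pair_fst p == j) && (pair_snd p == i)).
    by rewrite pair_indexC pair_fstK.
  by rewrite subrr !mulr0.
have tau (s : 'S_5) i j k : ~~ odd_perm s -> i != j -> j != k -> i != k ->
    nu' i j * nu' j k * nu' i k = nu' (s i) (s j) * nu' (s j) (s k) * nu' (s i) (s k).
  move=> es ij jk ik; have [a oa aE] := hD s es.
  (* [a] permutes the lines spanned by the e_lm with signs that [D] prescribes. *)
  have ae l m : a *m skew_unit C l m *m a^T =
      (nu' l m * nu' (s l) (s m)) *: skew_unit C (s l) (s m).
    rewrite -[LHS]skew_coordK ?skew_conj_tr ?tr_skew_unit //.
    rewrite skew_coord_conj ?tr_skew_unit // -aE -!mulmxA De -!scalemxAr.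
    rewrite -skew_coord_conj ?tr_skew_unit // skew_unit_perm De scalerA.
    rewrite -[RHS]skew_coordK; last by rewrite tr_scalemx tr_skew_unit scalerN.
    by congr skew_of_coord; apply/colP => p; rewrite !mxE.
  have conjM (X Y : 'M[C]_5) : a *m X *m a^T *m (a *m Y *m a^T) = a *m (X *m Y) *m a^T.
    by rewrite -!mulmxA (mulmxA a^T a) oa mul1mx.
  have := ae i k; rewrite -(skew_unit_bracket C ij jk ik) mulmxBr mulmxBl -!conjM !ae.
  rewrite -!scalemxAl -!scalemxAr !scalerA [X in _ - X *: _]mulrC -scalerBr.
  rewrite skew_unit_bracket ?(inj_eq perm_inj) //.
  move/matrixP/(_ (s i) (s k)); rewrite !mxE !eqxx /=.
  rewrite (inj_eq perm_inj) (negPf ik) subr0 !mulr1.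
  have nn l m : nu' l m * nu' l m = 1 by apply: nu2.
  by apply: sign_triangle; exact: nn.
(* Pairs are numbered 01, 02, 03, 04, 12, 13, 14, 23, 24, 34 from 0 to 9. *)
pose n k := nu 0 (inord k).
have nE i j : nu' i j = n (pair_index i j) by rewrite /n inord_val.
pose i0 : 'I_5 := @Ordinal 5 0 isT; pose i1 : 'I_5 := @Ordinal 5 1 isT.
pose i2 : 'I_5 := @Ordinal 5 2 isT; pose i3 : 'I_5 := @Ordinal 5 3 isT.
pose i4 : 'I_5 := @Ordinal 5 4 isT.
pose s := (tperm i1 i3 * tperm i2 i4)%g; pose t := (tperm i3 i4 * tperm i1 i2)%g.
have [s0 s1 s2] : [/\ s i0 = i0, s i1 = i3 & s i2 = i4].
  split; rewrite permM; [by rewrite !tpermD | by rewrite tpermL tpermD |].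
  by rewrite [tperm i1 i3 i2]tpermD // tpermL.
have [t1 t2 t3] : [/\ t i1 = i2, t i2 = i1 & t i3 = i4].
  split; rewrite permM; last by rewrite tpermL tpermD.
    by rewrite [tperm i3 i4 i1]tpermD // tpermL.
  by rewrite [tperm i3 i4 i2]tpermD // tpermR.
have es : ~~ odd_perm s by rewrite odd_mul_tperm odd_tperm.
have et : ~~ odd_perm t by rewrite odd_mul_tperm odd_tperm.
have := tau s i0 i1 i2 es isT isT isT; have := tau t i1 i2 i3 et isT isT isT.
rewrite s0 s1 s2 t1 t2 t3 !nE /= => T2 T1.
rewrite NE det_mulmx detq mul1r det_diag.
have -> : \prod_i nu 0 i = \prod_(i < 10) n i.
  by apply: eq_bigr => p _; rewrite /n inord_val.
rewrite !big_ord_recl big_ord0 /=.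
have n2 k : n k * n k = 1 by apply: nu2.
have {}T1 : n 0%N * n 4%N * n 1%N = n 2%N * n 9%N * n 3%N := T1.
have {}T2 : n 7%N * n 5%N = n 6%N * n 8%N.
  have E : n 4%N * n 7%N * n 5%N = n 4%N * n 6%N * n 8%N := T2.
  rewrite -[LHS]mul1r -[RHS]mul1r -(n2 4%N).
  transitivity (n 4%N * (n 4%N * n 7%N * n 5%N)); first by ring.
  by rewrite E; ring.
transitivity (n 0%N * n 4%N * n 1%N * (n 2%N * n 9%N * n 3%N) * (n 7%N * n 5%N * (n 6%N * n 8%N))).
  by rewrite /bump /=; ring.
rewrite T1 T2.
transitivity ((n 2%N * n 2%N) * (n 9%N * n 9%N) * (n 3%N * n 3%N) *
  (n 6%N * n 6%N) * (n 8%N * n 8%N)); first by ring.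
by rewrite !n2 !mulr1.
Qed.
End Normalizer.

(** * Isotropic frames of commuting orthogonal matrices *)

Section CommonEigenvector.
Variable C : numClosedFieldType.

Lemma stable_eigenvector n (V t : 'M[C]_n) : V != 0 -> stablemx V t ->
  exists a, (V :&: eigenspace t a)%MS != 0.
Proof.
move=> V0 Vt; have rV : (0 < \rank V)%N by rewrite lt0n mxrank_eq0.
have sB : stablemx (row_base V) t by rewrite stablemx_row_base.
have [a /eigenvalueP[w wE w0]] := eigenvalue_closed (conjmx (row_base V) t) rV.
exists a; have wB0 : w *m row_base V != 0.
  by rewrite mulmx_free_eq0 // row_base_free.
apply: contra_neq wB0 => E; apply/eqP; rewrite -submx0 -E sub_capmx.
rewrite (submx_trans (submxMl _ _)) ?eq_row_base //=; apply/eigenspaceP.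
have -> : w *m row_base V *m t = w *m conjmx (row_base V) t *m row_base V.
  by rewrite /conjmx -[RHS]mulmxA mulmxKpV ?mulmxA.
by rewrite wE scalemxAl.
Qed.

(** In a nonzero stable subspace of minimal rank every member of [S] has an
eigenspace, which is again stable and so is everything. This works for an
arbitrary commuting set [S], finite or not. *)
Lemma common_eigenrow n (S : 'M[C]_n -> Prop) (W : 'M[C]_n) : W != 0 ->
  (forall t, S t -> stablemx W t) ->
  (forall s t, S s -> S t -> s *m t = t *m s) ->
  exists v : 'rV[C]_n, [/\ v != 0, (v <= W)%MS &
    forall t, S t -> exists a, v *m t = a *: v].
Proof.
move=> W0 WS cS.
pose P r := `[< exists V : 'M[C]_n, [/\ V != 0, (V <= W)%MS,
  forall t, S t -> stablemx V t & \rank V = r] >].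
have exP : exists r, P r by exists (\rank W); apply/asboolP; exists W.
case: (ex_minnP exP) => r /asboolP[V [V0 VW VS rV]] minr.
exists (nz_row V); split; first by rewrite nz_row_eq0.
  exact: submx_trans (nz_row_sub V) VW.
move=> t St; have [a Va0] := stable_eigenvector V0 (VS t St).
have Va : (V <= eigenspace t a)%MS.
  have : (V <= V :&: eigenspace t a)%MS.
    rewrite -(geq_leqif (mxrank_leqif_sup (capmxSl _ _))) rV.
    apply: minr; apply/asboolP; exists (V :&: eigenspace t a)%MS; split=> //.
      exact: submx_trans (capmxSl _ _) VW.
    move=> s Ss; rewrite (submx_trans (capmxMr _ _ _)) // capmxS ?VS //.
    by apply: comm_mx_stable_eigenspace; apply: cS.
  by move/submx_trans; apply; apply: capmxSr.
exists a; apply/eigenspaceP; exact: submx_trans (nz_row_sub V) Va.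
Qed.
End CommonEigenvector.

Section Frames.
Variable R : rcfType.
Local Notation C := R[i].
Local Notation rc := (real_complex R).
Local Notation "A %:CM" := (map_mx rc A) (at level 2, format "A %:CM").
Local Notation "A ^cj" := (map_mx (@Num.conj_op C) A) (at level 2, format "A ^cj").

Lemma conj_real_complex (x : R) : (rc x)^* = rc x.
Proof. by apply: conj_Creal; rewrite complex_real. Qed.

Lemma conjmx_real m n (A : 'M[R]_(m, n)) : A%:CM^cj = A%:CM.
Proof. by apply/matrixP => i j; rewrite !mxE conj_real_complex. Qed.

Lemma conjmxK m n (A : 'M[C]_(m, n)) : A^cj^cj = A.
Proof. by apply/matrixP => i j; rewrite !mxE conjCK. Qed.

Lemma conjmxZ m n a (A : 'M[C]_(m, n)) : (a *: A)^cj = a^* *: A^cj.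
Proof. by apply/matrixP => i j; rewrite !mxE rmorphM. Qed.

Lemma rV_norm_eq0 n (v : 'rV[C]_n) : (v *m v^t* == 0) = (v == 0).
Proof.
apply/eqP/eqP => [|->]; last by rewrite mul0mx.
move/matrixP/(_ 0 0); rewrite !mxE => /eqP.
rewrite psumr_eq0 => [/allP h|i _]; last by rewrite !mxE mul_conjC_ge0.
apply/rowP => i; have := h i; rewrite mem_index_enum !mxE mul_conjC_eq0.
by move/(_ isT)/eqP.
Qed.

Lemma normalize_row n (v : 'rV[C]_n) : v != 0 ->
  exists2 a : C, a^* = a & a != 0 /\ (a *: v) *m (a *: v)^t* = 1%:M.
Proof.
rewrite -rV_norm_eq0 => v0; pose s := (v *m v^t*) 0 0.
have sE : v *m v^t* = s%:M by rewrite [LHS]mx11_scalar.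
have s_ge0 : 0 <= s.
  by rewrite /s !mxE sumr_ge0 // => i _; rewrite !mxE mul_conjC_ge0.
have s0 : s != 0.
  by apply: contraNneq v0 => s0; rewrite sE s0 raddf0.
have sr : sqrtC s \is Num.real by rewrite ger0_real ?sqrtC_ge0.
exists (sqrtC s)^-1; first by rewrite conj_Creal // rpredV.
rewrite invr_eq0 sqrtC_eq0 s0; split=> //.
rewrite tr_scalemx conjmxZ -scalemxAl -scalemxAr scalerA sE conj_Creal ?rpredV //.
by rewrite -invfM -expr2 sqrtCK scale_scalar_mx mulVf.
Qed.

Definition orthogonal_family n (S : 'M[R]_n -> Prop) :=
  (forall t, S t -> t *m t^T = 1%:M) /\
  (forall s t, S s -> S t -> s *m t = t *m s).

Definition isotropic p n (U : 'M[C]_(p, n)) := U *m U^t* = 1%:M /\ U *m U^T = 0.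

(** The rows u_j of a frame are common eigenvectors such that the real and imaginary
parts of all the sqrt(2) u_j are orthonormal: each row describes a real plane on
which [S] acts by rotations. *)
Definition isotropic_frame n (S : 'M[R]_n -> Prop) p (U : 'M[C]_(p, n)) :=
  [/\ U *m U^t* = 1%:M, U *m U^T = 0 &
      forall t, S t -> exists d, U *m t%:CM = diag_mx d *m U].

(** The kernel on which the next common eigenvector is sought has to be defined
over the reals and stable under [S]; the two conditions are preserved when
more vectors are required to be orthogonal to it. *)
Definition invariant_kernel n (S : 'M[R]_n -> Prop) r (B : 'M[C]_(n, r)) :=
  forall v : 'rV[C]_n, v *m B = 0 ->
    v^cj *m B = 0 /\ forall t, S t -> v *m t%:CM *m B = 0.

Lemma invariant_kernel_row n S r1 r2 (B1 : 'M[C]_(n, r1)) (B2 : 'M[C]_(n, r2)) :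
  invariant_kernel S B1 -> invariant_kernel S B2 -> invariant_kernel S (row_mx B1 B2).
Proof.
move=> h1 h2 v; rewrite mul_mx_row -row_mx0 => /eq_row_mx[/h1[c1 t1] /h2[c2 t2]].
split; first by rewrite mul_mx_row c1 c2 row_mx0.
by move=> t St; rewrite mul_mx_row t1 // t2 // row_mx0.
Qed.

Lemma frame_tr n p (U : 'M[C]_(p, n)) t d :
  t *m t^T = 1%:M -> U *m U^t* = 1%:M -> U *m t%:CM = diag_mx d *m U ->
  diag_mx d *m (diag_mx d)^cj = 1%:M /\ U *m (t%:CM)^T = (diag_mx d)^cj *m U.
Proof.
move=> ot uU tU.
have otC : t%:CM *m (t%:CM)^T = 1%:M by rewrite map_trmx -map_mxM ot map_mx1.
have dd : diag_mx d *m (diag_mx d)^cj = 1%:M.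
  have : (U *m t%:CM) *m (U *m t%:CM)^t* = 1%:M.
    rewrite trmx_mul map_mxM [in X in _ *m (X *m _)]map_trmx conjmx_real -map_trmx.
    by rewrite mulmxA -(mulmxA U) otC mulmx1.
  rewrite tU trmx_mul map_mxM tr_diag_mx mulmxA -(mulmxA _ U) uU mulmx1.
  by [].
split=> //; have dd' := mulmx1C dd.
by rewrite -[LHS]mul1mx -dd' -[LHS]mulmxA (mulmxA _ U) -tU -(mulmxA U) otC mulmx1.
Qed.

Lemma frame_invariant_kernel n (S : 'M[R]_n -> Prop) p (U : 'M[C]_(p, n)) :
  orthogonal_family S -> isotropic_frame S U ->
  invariant_kernel S (row_mx (U^t*) U^T).
Proof.
move=> [oS _] [uU _ hU] v; rewrite mul_mx_row -row_mx0 => /eq_row_mx[v1 v2]; split.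
  rewrite mul_mx_row; have -> : v^cj *m U^t* = 0 by rewrite -map_mxM v2 map_mx0.
  suff -> : v^cj *m U^T = 0 by rewrite row_mx0.
  by rewrite -[U^T]conjmxK -map_mxM v1 map_mx0.
move=> t St; have [d tU] := hU t St.
have [_ tU'] := frame_tr (oS t St) uU tU.
have E : t%:CM *m U^T = U^T *m (diag_mx d)^cj.
  by rewrite -[LHS]trmxK trmx_mul trmxK tU' trmx_mul map_diag_mx tr_diag_mx.
rewrite mul_mx_row -mulmxA.
have -> : t%:CM *m U^t* = U^t* *m diag_mx d.
  by rewrite -[t%:CM]conjmx_real -map_mxM E map_mxM conjmxK.
by rewrite -[X in row_mx _ X]mulmxA E !mulmxA v1 v2 !mul0mx row_mx0.
Qed.

Lemma real_eigenrow_invariant_kernel n (S : 'M[R]_n -> Prop) (v : 'rV[C]_n) :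
  orthogonal_family S -> v^cj = v ->
  (forall t, S t -> exists2 a, a != 0 & v *m t%:CM = a *: v) ->
  invariant_kernel S v^T.
Proof.
move=> [oS _] rv hv w wv; split.
  by rewrite -rv map_trmx -map_mxM wv map_mx0.
move=> t St; have [a a0 av] := hv t St.
have otC : t%:CM *m (t%:CM)^T = 1%:M by rewrite map_trmx -map_mxM oS // map_mx1.
have : v *m (t%:CM)^T = a^-1 *: v.
  apply: (scalerI a0); rewrite scalerA divff // scale1r scalemxAl -av.
  by rewrite -mulmxA otC mulmx1.
move/(congr1 trmx); rewrite trmx_mul trmxK tr_scalemx -mulmxA => ->.
by rewrite -scalemxAr wv scaler0.
Qed.

(** If [v t = a v] with [t] orthogonal then v v^T = a^2 v v^T. So a common
eigenvector is isotropic unless all its eigenvalues are signs, and in that case its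
real or its imaginary part is a real common eigenvector. *)
Lemma isotropic_or_real_eigenrow n (S : 'M[R]_n -> Prop) r (B : 'M[C]_(n, r)) :
  orthogonal_family S -> invariant_kernel S B -> (r < n)%N ->
  exists v : 'rV[C]_n, [/\ v *m v^t* = 1%:M, v *m B = 0 &
   ((v *m v^T = 0 /\ forall t, S t -> exists a, v *m t%:CM = a *: v) \/
    (v^cj = v /\ forall t, S t -> v *m t%:CM = v \/ v *m t%:CM = - v))].
Proof.
move=> [oS cS] kB rn.
pose SC (A : 'M[C]_n) := exists2 t, S t & A = t%:CM.
have [||| v [v0 vB hv]] := @common_eigenrow C n SC (kermx B).
- by rewrite -mxrank_eq0 mxrank_ker subn_eq0 -ltnNge (leq_ltn_trans (rank_leq_col B)).
- move=> _ [t St ->]; apply/row_subP => i; rewrite row_mul; apply/sub_kermxP.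
  by have [|_ ->] := kB (row i (kermx B)); rewrite // -row_mul mulmx_ker row0.
- by move=> _ _ [s Ss ->] [t St ->]; rewrite -!map_mxM cS.
have {}vB : v *m B = 0 by apply/sub_kermxP.
have {}hv t : S t -> exists a, v *m t%:CM = a *: v by move=> St; apply: hv; exists t.
have [vv|vv] := eqVneq (v *m v^T) 0.
  have [a ra [a0 nv]] := normalize_row v0.
  exists (a *: v); split=> //; first by rewrite -scalemxAl vB scaler0.
  left; split; first by rewrite tr_scalemx -scalemxAl -scalemxAr vv !scaler0.
  move=> t /hv[b bE]; exists b.
  by rewrite -scalemxAl bE !scalerA mulrC.
have {}hv t : S t -> v *m t%:CM = v \/ v *m t%:CM = - v.
  move=> St; have [a aE] := hv t St.
  have : a ^+ 2 == 1.
    have : (a *: v) *m (a *: v)^T = v *m v^T.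
      rewrite -aE trmx_mul mulmxA -(mulmxA v) map_trmx -map_mxM oS // map_mx1.
      by rewrite mulmx1.
    rewrite tr_scalemx -scalemxAl -scalemxAr scalerA -expr2 -[RHS]scale1r.
    by move/eqP; rewrite -subr_eq0 -scalerBl scaler_eq0 (negPf vv) orbF subr_eq0.
  rewrite sqrf_eq1 aE => /orP[] /eqP ->; rewrite ?scale1r ?scaleN1r; by [left|right].
have [cB _] := kB v vB.
have hc t : S t -> v^cj *m t%:CM = (v *m t%:CM)^cj by rewrite map_mxM conjmx_real.
have [w [w0 wB rw hw]] : exists w : 'rV[C]_n, [/\ w != 0, w *m B = 0, w^cj = w &
    forall t, S t -> w *m t%:CM = w \/ w *m t%:CM = - w].
  have [e|ne] := eqVneq (v + v^cj) 0.
    have vc : v^cj = - v by apply/eqP; rewrite -addr_eq0 addrC e.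
    exists ('i *: v); split.
    - by rewrite scaler_eq0 negb_or neq0Ci v0.
    - by rewrite -scalemxAl vB scaler0.
    - by rewrite conjmxZ conjCi vc scaleNr scalerN opprK.
    move=> t /hv[] E; rewrite -scalemxAl E ?scalerN; by [left|right].
  exists (v + v^cj); split=> //.
  - by rewrite mulmxDl vB cB addr0.
  - by rewrite map_mxD conjmxK addrC.
  move=> t St; rewrite mulmxDl hc //.
  case: (hv t St) => ->; [by left | right].
  by rewrite map_mxN opprD.
have [a ra [a0 nw]] := normalize_row w0.
exists (a *: w); split=> //; first by rewrite -scalemxAl wB scaler0.
right; split; first by rewrite conjmxZ ra rw.
move=> t St; rewrite -scalemxAl.
by case: (hw t St) => ->; [left | right; rewrite scalerN].
Qed.

Lemma trmxC_mul m n p (A : 'M[C]_(m, n)) (B : 'M[C]_(n, p)) :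
  (A *m B)^t* = B^t* *m A^t*.
Proof. by rewrite trmx_mul map_mxM. Qed.

Lemma col_unitary p1 p2 n (A : 'M[C]_(p1, n)) (B : 'M[C]_(p2, n)) :
  A *m A^t* = 1%:M -> B *m B^t* = 1%:M -> A *m B^t* = 0 ->
  col_mx A B *m (col_mx A B)^t* = 1%:M.
Proof.
move=> AA BB AB; have BA : B *m A^t* = 0.
  by rewrite -[LHS]trmxCK trmxC_mul trmxCK AB trmx0 map_mx0.
by rewrite tr_col_mx map_row_mx mul_col_row AA BB AB BA -scalar_mx_block.
Qed.

(** The size [q] is kept apart from [n] so that block matrices can be used for
[Q] without casts. *)
Lemma det_intertwine q n (Q : 'M[C]_(q, n)) (D : 'M[C]_q) (k : 'M[C]_n) : q = n ->
  Q *m Q^t* = 1%:M -> Q *m k = D *m Q -> \det k = \det D.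
Proof.
move=> qn; subst q => QQ Qk.
have [Q0 _] := mulmx1_unit QQ; rewrite unitmxE unitfE in Q0.
by apply: (mulfI Q0); rewrite -det_mulmx Qk det_mulmx mulrC.
Qed.

Lemma conj_unitary p n (U : 'M[C]_(p, n)) : U *m U^t* = 1%:M -> U^cj *m U^cj^t* = 1%:M.
Proof. by move=> uU; rewrite map_trmx -map_mxM uU map_mx1. Qed.

Lemma conj_isotropic p n (U : 'M[C]_(p, n)) : U *m U^T = 0 -> U *m U^cj^t* = 0.
Proof. by move=> UU; rewrite map_trmx conjmxK. Qed.

(** For a frame of half the dimension this is a unitary change of basis that
turns the real matrices of the frame torus into diag(d, conj d). *)
Definition with_conj p n (U : 'M[C]_(p, n)) := col_mx U U^cj.

Lemma with_conj_unitary p n (U : 'M[C]_(p, n)) : isotropic U ->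
  with_conj U *m (with_conj U)^t* = 1%:M.
Proof. by move=> [uU iU]; rewrite col_unitary ?conj_unitary ?conj_isotropic. Qed.

Lemma frame_extend n (S : 'M[R]_n -> Prop) p (U : 'M[C]_(p, n)) (w : 'rV[C]_n) :
  isotropic_frame S U -> w *m row_mx (U^t*) U^T = 0 ->
  w *m w^t* = 1%:M -> w *m w^T = 0 ->
  (forall t, S t -> exists a, w *m t%:CM = a *: w) ->
  @isotropic_frame n S (1 + p) (col_mx w U).
Proof.
move=> [uU iU hU]; rewrite mul_mx_row -row_mx0 => /eq_row_mx[wU1 wU2] uw iw hw.
split; first exact: (@col_unitary 1 p n w U).
  rewrite tr_col_mx mul_col_row iw wU2 iU.
  by rewrite -[U *m w^T]trmxK trmx_mul trmxK wU2 trmx0 block_mx0.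
move=> t St; have [d dE] := hU t St; have [a aE] := hw t St.
exists (row_mx a%:M d : 'rV_(1 + p)).
rewrite diag_mx_row mul_block_col !mul0mx addr0 add0r.
rewrite (mul_col_mx w U) aE dE; congr col_mx.
by rewrite (_ : diag_mx a%:M = a%:M) ?mul_scalar_mx // [RHS]mx11_scalar;
  apply/matrixP => i j; rewrite !mxE !ord1 !eqxx.
Qed.

Definition real_sign_row n (S : 'M[R]_n -> Prop) (v : 'rV[C]_n) :=
  [/\ v *m v^T = 1%:M, v^cj = v &
      forall t, S t -> v *m t%:CM = v \/ v *m t%:CM = - v].

(** Two real eigenvectors with the same signs span a plane on which [S] acts by
signs; (v1 + i v2) / sqrt(2) is an isotropic vector of that plane. *)
Lemma frame_extend_real n (S : 'M[R]_n -> Prop) p (U : 'M[C]_(p, n)) v1 v2 :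
  isotropic_frame S U -> real_sign_row S v1 -> real_sign_row S v2 ->
  v1 *m row_mx (U^t*) U^T = 0 -> v2 *m row_mx (U^t*) U^T = 0 ->
  v2 *m v1^T = 0 ->
  (forall t, S t -> exists a, v1 *m t%:CM = a *: v1 /\ v2 *m t%:CM = a *: v2) ->
  exists U' : 'M[C]_(p.+1, n), isotropic_frame S U'.
Proof.
move=> fU [u1 r1 _] [u2 r2 _] k1 k2 v21 same.
have v12 : v1 *m v2^T = 0 by rewrite -[LHS]trmxK trmx_mul trmxK v21 trmx0.
pose a : C := (sqrtC 2%:R)^-1.
have aa : a * a = 2%:R^-1 by rewrite /a -invfM -expr2 sqrtCK.
have ii : 'i * 'i = -1 :> C by rewrite -expr2 sqrCi.
have ra : a^* = a by rewrite conj_Creal // rpredV ger0_real // sqrtC_ge0 ler0n.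
pose w := a *: (v1 + 'i *: v2).
have wt : w^T = a *: (v1^T + 'i *: v2^T) by rewrite tr_scalemx linearD /= tr_scalemx.
have wc : w^t* = a *: (v1^T - 'i *: v2^T).
  rewrite wt conjmxZ ra map_mxD conjmxZ conjCi -!map_trmx r1 r2.
  by rewrite scaleNr.
exists (col_mx w U : 'M_(1 + p, n)); apply: frame_extend => //.
- by rewrite /w -scalemxAl mulmxDl -scalemxAl k1 k2 scaler0 addr0 scaler0.
- rewrite wc /w -scalemxAl -scalemxAr mulmxBr !mulmxDl -!scalemxAr -!scalemxAl.
  rewrite u1 u2 v12 v21 !scaler0 addr0 add0r !scalerA ii scaleN1r opprK.
  by rewrite aa -[1%:M + _]mulr2n -[1%:M *+ 2]scaler_nat scalerA mulVf ?scale1r ?pnatr_eq0.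
- rewrite wt /w -scalemxAl -scalemxAr mulmxDr !mulmxDl -!scalemxAr -!scalemxAl.
  rewrite u1 u2 v12 v21 !scaler0 addr0 add0r !scalerA ii scaleN1r subrr.
  by rewrite scaler0.
move=> t /same[b [b1 b2]]; exists b.
by rewrite /w -scalemxAl mulmxDl -scalemxAl b1 b2 !scalerDr !scalerA
  ![_ * b]mulrC mulrA [b * a]mulrC -[a * b * 'i]mulrA [b * 'i]mulrC mulrA.
Qed.

(** [B] collects the real eigenvectors already found; a failure to extend the
frame yields a further one. *)
Lemma frame_extend_or_real n (S : 'M[R]_n -> Prop) p (U : 'M[C]_(p, n)) r (B : 'M[C]_(n, r)) :
  orthogonal_family S -> isotropic_frame S U -> invariant_kernel S B ->
  (p + p + r < n)%N ->
  (exists U' : 'M[C]_(p.+1, n), isotropic_frame S U') \/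
  exists v, [/\ real_sign_row S v, v *m row_mx (U^t*) U^T = 0 & v *m B = 0].
Proof.
move=> oS fU kB lt.
have kU := invariant_kernel_row (frame_invariant_kernel oS fU) kB.
have [v [nv vB hv]] := isotropic_or_real_eigenrow oS kU lt.
have [vB1 vB2] : v *m row_mx (U^t*) U^T = 0 /\ v *m B = 0.
  by move: vB; rewrite mul_mx_row -[in RHS]row_mx0 => /eq_row_mx.
case: hv => [[iv ev]|[rv ev]].
  by left; exists (col_mx v U : 'M_(1 + p, n)); apply: frame_extend.
right; exists v; split=> //; split=> //.
by rewrite -[v in v^T]rv map_trmx.
Qed.

Lemma real_sign_row_kernel n (S : 'M[R]_n -> Prop) v :
  orthogonal_family S -> real_sign_row S v -> invariant_kernel S v^T.
Proof.
move=> oS [_ rv ev]; apply: real_eigenrow_invariant_kernel => // t /ev[] ->.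
  by exists 1; rewrite ?oner_eq0 ?scale1r.
by exists (-1); rewrite ?oppr_eq0 ?oner_eq0 ?scaleN1r.
Qed.

Lemma frame0 n (S : 'M[R]_n -> Prop) : isotropic_frame S (0 : 'M[C]_(0, n)).
Proof.
split; try by apply/matrixP => -[].
by move=> t St; exists 0; apply/matrixP => -[].
Qed.

Lemma frame_exists n m (S : 'M[R]_n -> Prop) :
  (forall p (U : 'M[C]_(p, n)), (p < m)%N -> isotropic_frame S U ->
     exists U' : 'M[C]_(p.+1, n), isotropic_frame S U') ->
  exists U : 'M[C]_(m, n), isotropic_frame S U.
Proof.
move=> step; have: forall p, (p <= m)%N -> exists U : 'M[C]_(p, n), isotropic_frame S U.
  elim=> [_|p IH pm]; first by exists 0; apply: frame0.
  by have [U fU] := IH (ltnW pm); apply: step fU.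
by apply.
Qed.

(** For a connected torus every real sign character is trivial, so any two real
common eigenvectors can be combined into an isotropic one. *)
Lemma frame_of_fixing n m (S : 'M[R]_n -> Prop) : n = (m + m)%N ->
  orthogonal_family S ->
  (forall v, real_sign_row S v -> forall t, S t -> v *m t%:CM = v) ->
  exists U : 'M[C]_(m, n), isotropic_frame S U.
Proof.
move=> nm oS fixS; apply: frame_exists => p U pm fU.
have np : (p + p + 1 < n)%N by rewrite nm addn1 -addnS -addSn leq_add.
have k0 : invariant_kernel S (0 : 'M_(n, 0)).
  by move=> v _; split=> [|t _]; rewrite mulmx0.
have [|//|[v1 [s1 k1 _]]] := frame_extend_or_real oS fU k0.
  by rewrite addn0 (leq_trans _ np) // addn1.
have [|//|[v2 [s2 k2 v21]]] := frame_extend_or_real oS fU (real_sign_row_kernel oS s1).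
  by [].
apply: (frame_extend_real fU s1 s2) => // t St; exists 1.
by rewrite !scale1r !fixS.
Qed.

(** A single special orthogonal matrix. Among three real eigenvectors two have the
same sign, so the construction can only get stuck on a last plane with eigenvalues
1 and -1; then the determinant would be -1. *)
Lemma frame_of_special n m (k : 'M[R]_n) : n = (m + m)%N ->
  k *m k^T = 1%:M -> \det k = 1 ->
  exists U : 'M[C]_(m, n), isotropic_frame (eq k) U.
Proof.
move=> nm ok dk.
have oS : orthogonal_family (eq k) by split=> [_ <-//|_ _ <- <-].
apply: frame_exists => p U pm fU.
have k0 : invariant_kernel (eq k) (0 : 'M_(n, 0)).
  by move=> v _; split=> [|t _]; rewrite mulmx0.
have np : (p + p + 1 < n)%N by rewrite nm addn1 -addnS -addSn leq_add.
have [|//|[v1 [s1 k1 _]]] := frame_extend_or_real oS fU k0.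
  by rewrite addn0 (leq_trans _ np) // addn1.
have [|//|[v2 [s2 k2 v21]]] := frame_extend_or_real oS fU (real_sign_row_kernel oS s1).
  by [].
have sign v : real_sign_row (eq k) v -> exists b : bool, v *m k%:CM = (-1) ^+ b *: v.
  move=> [_ _ /(_ k erefl)[] E]; first by exists false; rewrite scale1r.
  by exists true; rewrite expr1 scaleN1r.
have same u v b : real_sign_row (eq k) u -> real_sign_row (eq k) v ->
    u *m row_mx (U^t*) U^T = 0 -> v *m row_mx (U^t*) U^T = 0 -> v *m u^T = 0 ->
    u *m k%:CM = (-1) ^+ b *: u -> v *m k%:CM = (-1) ^+ b *: v ->
    exists U' : 'M[C]_(p.+1, n), isotropic_frame (eq k) U'.
  move=> su sv ku kv uv ub vb; apply: (frame_extend_real fU su sv) => // _ <-.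
  by exists ((-1) ^+ b).
have [b1 e1] := sign v1 s1; have [b2 e2] := sign v2 s2.
have [bb|bb] := eqVneq b1 b2; first by apply: (same v1 v2 b1) => //; rewrite bb.
have [np2|np2] := ltnP (p + p + (1 + 1)) n.
  have [|//|[v3 [s3 k3]]] := frame_extend_or_real oS fU
    (invariant_kernel_row (real_sign_row_kernel oS s1) (real_sign_row_kernel oS s2)).
    by [].
  rewrite mul_mx_row -row_mx0 => /eq_row_mx[v31 v32].
  have [b3 e3] := sign v3 s3.
  have [b13|b13] := eqVneq b1 b3; first by apply: (same v1 v3 b1) => //; rewrite b13.
  have b23 : b2 = b3 by move: bb b13; case: (b1); case: (b2); case: (b3).
  by apply: (same v2 v3 b2) => //; rewrite b23.
exfalso; have qn : (p + p + (1 + 1) = n)%N.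
  by apply/eqP; rewrite eqn_leq np2 andbT addnA addn1.
have [uU iU hU] := fU; have [d dE] := hU k erefl.
have [dd _] := frame_tr ok uU dE.
have [u1 r1 _] := s1; have [u2 r2 _] := s2.
pose Q := col_mx (col_mx U U^cj) (col_mx v1 v2).
have kc v : v *m row_mx (U^t*) U^T = 0 -> v *m (col_mx U U^cj)^t* = 0.
  rewrite mul_mx_row -[in RHS]row_mx0 => /eq_row_mx[w1 w2].
  rewrite tr_col_mx map_row_mx mul_mx_row w1.
  by rewrite -map_trmx conjmxK w2 row_mx0.
have rT v : v^cj = v -> v^t* = v^T by move=> rv; rewrite -map_trmx rv.
have QQ : Q *m Q^t* = 1%:M.
  apply: col_unitary; first exact: (with_conj_unitary (conj uU iU)).
    by apply: col_unitary; rewrite ?rT //; rewrite -[LHS]trmxK trmx_mul trmxK v21 trmx0.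
  rewrite -[LHS]trmxCK trmxC_mul trmxCK mul_col_mx !kc //.
  by rewrite col_mx0 trmx0 map_mx0.
pose D := block_mx (block_mx (diag_mx d) 0 0 (diag_mx d)^cj) 0 0
   (block_mx ((-1) ^+ b1)%:M 0 0 ((-1) ^+ b2)%:M : 'M[C]_(1 + 1)).
have Qk : Q *m k%:CM = D *m Q.
  rewrite /Q /D !(mul_block_col, mul_col_mx) !mul0mx !addr0 !add0r.
  congr (col_mx (col_mx _ _) (col_mx _ _)) => //.
  - by rewrite -map_mxM -dE map_mxM conjmx_real.
  - by rewrite mul_scalar_mx.
  - by rewrite mul_scalar_mx.
have := det_intertwine qn QQ Qk.
rewrite det_map_mx dk rmorph1 /D !det_ublock !det_scalar1 -det_mulmx dd det1 mul1r.
rewrite -signr_addb; move: bb; case: (b1); case: (b2) => //= _ /eqP.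
  by rewrite expr1 -addr_eq0 -mulr2n pnatr_eq0.
by rewrite expr1 -addr_eq0 -mulr2n pnatr_eq0.
Qed.
End Frames.

(** * Orthogonal matrices carrying one isotropic frame to another *)

(** Three unipotent factors multiply to the quarter turn with blocks 1 and -1, which
reduces the antidiagonal matrix to a diagonal one. *)
Lemma det_antidiag (F : comNzRingType) m (A B : 'M[F]_m) :
  \det (block_mx 0 A B 0) = (-1) ^+ m * (\det A * \det B).
Proof.
have -> : block_mx 0 A B 0 = block_mx 1%:M 1%:M 0 1%:M *m block_mx 1%:M 0 (- 1%:M) 1%:M
    *m block_mx 1%:M 1%:M 0 1%:M *m block_mx (- B) 0 0 A.
  rewrite !mulmx_block !(mulmx0, mul0mx, mulmx1, mul1mx, addr0, add0r, subrr).
  by rewrite !(mulNmx, mul1mx, opprK, addNr, addr0, add0r, mul0mx, oppr0).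
rewrite !det_mulmx !det_ublock det_lblock !det1 !mulr1 !mul1r -scaleN1r detZ.
by rewrite mulrAC mulrA.
Qed.

Section Transport.
Variable R : rcfType.
Local Notation C := R[i].
Local Notation rc := (real_complex R).
Local Notation "A %:CM" := (map_mx rc A) (at level 2, format "A %:CM").
Local Notation "A ^cj" := (map_mx (@Num.conj_op C) A) (at level 2, format "A ^cj").

(** The real matrix that carries the frame [U] to the frame [V], namely
U^* V plus its complex conjugate. *)
Definition transport p n (U V : 'M[C]_(p, n)) : 'M[R]_n :=
  map_mx (fun z => 2%:R * complex.Re z) (U^t* *m V).

Lemma two_Re (z : C) : rc (2%:R * complex.Re z) = z + z^*.
Proof.
by rewrite rmorphM rmorph_nat /= ReJ_add mulrC divfK ?pnatr_eq0.
Qed.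

Lemma transportE p n (U V : 'M[C]_(p, n)) : (transport U V)%:CM = U^t* *m V + U^T *m V^cj.
Proof.
have -> : U^T *m V^cj = (U^t* *m V)^cj by rewrite map_mxM conjmxK.
apply/matrixP => i j; rewrite [LHS]mxE [transport _ _ _ _]mxE two_Re [RHS]mxE.
by rewrite [X in _ = _ + X]mxE.
Qed.

Lemma mulmx_transport p n (U V : 'M[C]_(p, n)) : isotropic U -> U *m (transport U V)%:CM = V.
Proof. by move=> [uU iU]; rewrite transportE mulmxDr !mulmxA uU iU mul1mx mul0mx addr0. Qed.

Lemma isotropic_conj p n (U : 'M[C]_(p, n)) : isotropic U -> isotropic U^cj.
Proof.
move=> [uU iU]; split; first exact: conj_unitary.
by rewrite map_trmx -map_mxM iU map_mx0.
Qed.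

Variables m n : nat.
Hypothesis nm : n = (m + m)%N.
Implicit Types U V : 'M[C]_(m, n).

Lemma isotropic_complete U : isotropic U -> U^t* *m U + U^T *m U^cj = 1%:M.
Proof.
move: U; rewrite nm => U /with_conj_unitary /mulmx1C.
rewrite /with_conj tr_col_mx map_row_mx mul_row_col.
by rewrite map_trmx conjmxK.
Qed.

Lemma transport_uniq U V t : isotropic U -> U *m t%:CM = V -> t = transport U V.
Proof.
move=> iU tU; apply: (@map_mx_inj _ _ rc); rewrite transportE.
have -> : V^cj = U^cj *m t%:CM by rewrite -tU map_mxM conjmx_real.
by rewrite -tU !mulmxA -mulmxDl isotropic_complete // mul1mx.
Qed.

Lemma transport_orthogonal U V : isotropic U -> isotropic V ->
  transport U V *m (transport U V)^T = 1%:M.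
Proof.
move=> iU [uV iV]; apply: (@map_mx_inj _ _ rc).
have LT : ((transport U V)^T)%:CM = V^t* *m U + V^T *m U^cj.
  by rewrite -map_trmx transportE linearD /= !trmx_mul !map_trmx !trmxK addrC.
rewrite map_mxM map_mx1 LT transportE mulmxDl !mulmxDr -!mulmxA.
rewrite !(mulmxA V) !(mulmxA V^cj) uV iV mul1mx mul0mx mulmx0 addr0.
have -> : V^cj *m V^t* = 0 by rewrite -map_mxM iV map_mx0.
have -> : V^cj *m V^T = 1%:M by rewrite -[V^T]conjmxK -map_mxM uV map_mx1.
by rewrite mul0mx mulmx0 add0r mul1mx isotropic_complete.
Qed.

Lemma det_transport U V : isotropic U -> isotropic V ->
  forall t, U *m t%:CM = V -> forall D, with_conj V = D *m with_conj U ->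
  rc (\det t) = \det D.
Proof.
move=> iU iV t tU D DE; rewrite -det_map_mx.
apply: (det_intertwine (Q := with_conj U)); rewrite ?nm ?with_conj_unitary //.
by rewrite -DE /with_conj mul_col_mx tU; congr col_mx; rewrite -tU map_mxM conjmx_real.
Qed.

Lemma unit_diag_isotropic U d : isotropic U -> diag_mx d *m (diag_mx d)^cj = 1%:M ->
  isotropic (diag_mx d *m U).
Proof.
move=> [uU iU] dd; split.
  by rewrite trmxC_mul mulmxA -(mulmxA _ U) uU mulmx1 tr_diag_mx.
by rewrite trmx_mul mulmxA -(mulmxA _ U) iU mulmx0 mul0mx.
Qed.

Lemma transport_diag_special U d : isotropic U -> diag_mx d *m (diag_mx d)^cj = 1%:M ->
  special_orthogonal (transport U (diag_mx d *m U)).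
Proof.
move=> iU dd; have iV := unit_diag_isotropic iU dd; apply/andP; split; apply/eqP.
  exact/mulmx1C/transport_orthogonal.
apply: (@complexI R); rewrite rmorph1.
rewrite (det_transport iU iV (mulmx_transport _ iU)
  (D := block_mx (diag_mx d) 0 0 (diag_mx d)^cj)).
  by rewrite det_ublock -det_mulmx dd det1.
by rewrite /with_conj mul_block_col !mul0mx addr0 add0r map_mxM.
Qed.

(** Conjugating a frame of odd size m exchanges two blocks of size m, which
changes the sign of the determinant of the transport. *)
Lemma transport_special U V : odd m -> isotropic U -> isotropic V ->
  special_orthogonal (transport U V) \/ special_orthogonal (transport U V^cj).
Proof.
move=> om iU iV; have iV' := isotropic_conj iV.
have dsq W : isotropic W -> \det (transport U W) ^+ 2 = 1.
  by move=> iW; rewrite expr2 -{2}det_tr -det_mulmx transport_orthogonal ?det1.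
have [d1|d1] := eqVneq (\det (transport U V)) 1.
  by left; rewrite /special_orthogonal d1 (mulmx1C (transport_orthogonal iU iV)) !eqxx.
right; rewrite /special_orthogonal (mulmx1C (transport_orthogonal iU iV')) eqxx /=.
have dN : \det (transport U V) = -1.
  by move/eqP: (dsq V iV); rewrite sqrf_eq1 (negPf d1) => /eqP.
have <- : transport U V *m transport V V^cj = transport U V^cj.
  by apply: transport_uniq => //; rewrite map_mxM mulmxA !mulmx_transport.
suff E : \det (transport V V^cj) = -1 by rewrite det_mulmx dN E mulrNN mulr1.
apply: (@complexI R); rewrite (det_transport iV iV' (mulmx_transport _ iV)
  (D := block_mx 0 1%:M 1%:M 0)).
  by rewrite det_antidiag !det1 -signr_odd om expr1 rmorphN rmorph1 !mulr1.
by rewrite /with_conj mul_block_col !mul0mx !mul1mx addr0 add0r conjmxK.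
Qed.
End Transport.

(** * The torus attached to an isotropic frame *)

Section FrameTorus.
Variable R : realType.
Local Notation C := R[i].
Local Notation rc := (real_complex R).
Local Notation "A %:CM" := (map_mx rc A) (at level 2, format "A %:CM").
Local Notation "A ^cj" := (map_mx (@Num.conj_op C) A) (at level 2, format "A ^cj").

Lemma continuous_sum (T : topologicalType) (V : normedModType R) (I : Type)
    (r : seq I) (F : I -> T -> V) :
  (forall i, continuous (F i)) -> continuous (fun x => \sum_(i <- r) F i x).
Proof.
move=> cF x; rewrite /continuous_at; elim: r => [|i r IH].
  rewrite big_nil; under eq_cvg do rewrite big_nil; exact: cvg_cst.
rewrite big_cons; under eq_cvg do rewrite big_cons.
by apply: cvgD; [exact: cF|exact: IH].
Qed.

Lemma SO_val_continuous n : continuous (@SO_val R n).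
Proof. exact: initial_continuous. Qed.

Lemma quadratic_continuous n (x : 'rV[R]_n) :
  continuous (fun t : SO R n => (x *m (t : 'M_n) *m x^T) 0 0).
Proof.
have -> : (fun t : SO R n => (x *m (t : 'M_n) *m x^T) 0 0) =
    (fun t : SO R n => \sum_j \sum_i (x 0 i * x 0 j) * (t : 'M_n) i j).
  apply: funext => t; rewrite mxE; apply: eq_bigr => j _.
  rewrite !mxE big_distrl; apply: eq_bigr => i _ /=; ring.
apply: (@continuous_sum (SO R n) R^o) => j; apply: (@continuous_sum (SO R n) R^o) => i t.
apply: (@continuousM R (SO R n) (fun=> x 0 i * x 0 j)); first exact: cst_continuous.
apply: (continuous_comp (f := @SO_val R n) (g := fun M : 'M[R]_n => M i j)).
  exact: SO_val_continuous.
exact: coord_continuous.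
Qed.

(** The function t |-> v t v^T is continuous with values 1 and -1 on the connected
set [T], and it is 1 at the identity. *)
Lemma connected_sign_row n (T : set (SO R n)) (v : 'rV[C]_n) :
  connected T -> T 1%g ->
  real_sign_row (fun A => exists2 t : SO R n, T t & (t : 'M_n) = A) v ->
  forall t : SO R n, T t -> v *m (t : 'M_n)%:CM = v.
Proof.
move=> cT T1 [vv rv hv] t Tt.
pose x : 'rV[R]_n := map_mx (@complex.Re R) v.
have xE : v = x%:CM.
  apply/rowP => i; rewrite !mxE -[LHS]RRe_real //; apply/CrealP.
  by move/rowP/(_ i): rv; rewrite mxE.
pose f (s : SO R n) := (x *m (s : 'M_n) *m x^T) 0 0.
have fE s : rc (f s) = (v *m (s : 'M_n)%:CM *m v^T) 0 0.
  by rewrite xE map_trmx -!map_mxM [RHS]mxE.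
have f1 (s : SO R n) : v *m (s : 'M_n)%:CM = v -> f s = 1.
  by move=> sv; apply: (@complexI R); rewrite fE sv vv !mxE.
have fN (s : SO R n) : v *m (s : 'M_n)%:CM = - v -> f s = -1.
  by move=> sv; apply: (@complexI R); rewrite fE sv mulNmx vv !mxE rmorphN.
have [//|tN] := hv t (ex_intro2 _ _ t Tt erefl).
have cf : connected (f @` T).
  apply: connected_continuous_connected => //.
  exact/continuous_subspaceT/quadratic_continuous.
have [s Ts fs] : (f @` T) 0.
  have /connected_intervalP h := cf; apply: (h (-1) 1); last by rewrite oppr_le0 ler01.
    by exists t; rewrite ?fN.
  by exists 1%g; rewrite // f1 // map_mx1 mulmx1.
have [/f1|/fN] := hv s (ex_intro2 _ _ s Ts erefl); rewrite fs => /eqP.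
  by rewrite eq_sym oner_eq0.
by rewrite eq_sym oppr_eq0 oner_eq0.
Qed.


Definition expi (a : R) : C := Complex (cos a) (sin a).

Lemma expi_conj a : expi a * (expi a)^* = 1.
Proof. by rewrite -normCK -add_Re2_Im2 /= cos2Dsin2. Qed.

Lemma expi_surj (z : C) : z * z^* = 1 -> exists2 a, - pi <= a <= pi & z = expi a.
Proof.
rewrite -normCK -add_Re2_Im2; case: z => x y /= /(@complexI R) xy.
have x1 : -1 <= x <= 1.
  rewrite -ler_norml -(@expr_le1 _ 2) ?normr_ge0 // real_normK ?num_real //.
  by rewrite -xy lerDl sqr_ge0.
have := acos_ge0 x1; have := acos_lepi x1 => ap a0.
have ny : `|y| = sin (acos x).
  by rewrite sin_acos // -xy addrAC subrr add0r sqrtr_sqr.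
have [y0|y0] := leP 0 y.
  exists (acos x); first by rewrite ap andbT (le_trans _ a0) // oppr_le0 pi_ge0.
  by rewrite /expi acosK ?in_itv //= -ny ger0_norm.
exists (- acos x); first by rewrite lerN2 ap /= (le_trans _ (pi_ge0 _)) // oppr_le0.
by rewrite /expi cosN sinN acosK ?in_itv //= -ny ltr0_norm // opprK.
Qed.

Section Torus.
Variables m n : nat.
Hypothesis nm : n = (m + m)%N.
Variable U : 'M[C]_(m, n).
Hypothesis iU : isotropic U.

Definition frame_torus : set (SO R n) :=
  [set t : SO R n | exists d, U *m (t : 'M_n)%:CM = diag_mx d *m U].

Definition expi_row (a : 'rV[R]_m) : 'rV[C]_m := \row_j expi (a 0 j).

Lemma expi_row_unit a : diag_mx (expi_row a) *m (diag_mx (expi_row a))^cj = 1%:M.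
Proof.
rewrite map_diag_mx mulmx_diag -diag_const_mx; congr diag_mx; apply/rowP => j.
by rewrite !mxE expi_conj.
Qed.

Definition rotation (a : 'rV[R]_m) : SO R n :=
  MkSO (transport_diag_special nm iU (expi_row_unit a)).

Lemma rotation_torus a : frame_torus (rotation a).
Proof. by exists (expi_row a); rewrite mulmx_transport. Qed.

Lemma SO_orthogonal (t : SO R n) : (t : 'M_n) *m (t : 'M_n)^T = 1%:M.
Proof. by apply: mulmx1C; apply/eqP; case/andP: (SO_valP t). Qed.

(** Angles can be chosen in a fixed segment, which gives compactness. *)
Lemma frame_torus_rotation t : frame_torus t ->
  exists2 a : 'rV_m, (forall j, - pi <= a 0 j <= pi) & t = rotation a.
Proof.
move=> [d tU]; have [uU _] := iU.
have [dd _] := frame_tr (SO_orthogonal t) uU tU.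
have /fin_all_exists[a ha] j : exists a, - pi <= a <= pi /\ d 0 j = expi a.
  have [|a ? ?] := @expi_surj (d 0 j); last by exists a.
  have /matrixP/(_ j j) := dd; rewrite map_diag_mx mulmx_diag !mxE eqxx.
  by rewrite !mulr1n.
exists (\row_j a j) => [j|]; first by rewrite mxE; case: (ha j).
apply: val_inj => /=; rewrite [LHS](transport_uniq nm iU tU); congr transport.
congr (diag_mx _ *m _).
by apply/rowP => j; rewrite !mxE; case: (ha j).
Qed.

Lemma rotation_continuous : continuous rotation.
Proof.
apply: continuous_comp_initial.
pose A j := \matrix_(a, b) (2%:R * complex.Re ((U j a)^* * U j b)) : 'M[R]_n.
pose B j := \matrix_(a, b) (- (2%:R * complex.Im ((U j a)^* * U j b))) : 'M[R]_n.
have -> : SO_val (n := n) \o rotation =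
    (fun a => \sum_j (cos (a 0 j) *: A j + sin (a 0 j) *: B j)).
  apply: funext => a; apply/matrixP => k l; rewrite /= /transport mul_diag_mx mxE summxE mxE.
  rewrite raddf_sum mulr_sumr; apply: eq_bigr => j _.
  rewrite !mxE; case: (_^*) => x y; case: (U j l) => z t /=; ring.
apply: (@continuous_sum _ 'M[R]_n) => j x.
have ca : {for x, continuous (fun a : 'rV[R]_m => a 0 j)} by apply: coord_continuous.
have cc : {for x, continuous (fun a : 'rV[R]_m => cos (a 0 j))}.
  by apply: (continuous_comp ca); apply: continuous_cos.
have cs : {for x, continuous (fun a : 'rV[R]_m => sin (a 0 j))}.
  by apply: (continuous_comp ca); apply: continuous_sin.
have hc := @continuousZr_tmp R 'M[R]_n _ _ (A j) x cc.
have hs := @continuousZr_tmp R 'M[R]_n _ _ (B j) x cs.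
exact: (continuousD hc hs).
Qed.

Lemma frame_torus_compact : compact frame_torus.
Proof.
have -> : frame_torus = rotation @`
    [set a : 'rV_m | forall j, (`[- pi, pi]%classic : set R) (a ord0 j)].
  apply/seteqP; split=> [t /frame_torus_rotation[a ha ->]|_ [a _ <-]]; last exact: rotation_torus.
  by exists a => // j; rewrite /= in_itv.
apply: continuous_compact; first exact/continuous_subspaceT/rotation_continuous.
by apply: (@rV_compact R m (fun=> `[- pi, pi]%classic)) => _; apply: segment_compact.
Qed.

(** The torus is a union of arcs s |-> rotation (s a) issued from the identity. *)
Lemma frame_torus_connected : connected frame_torus.
Proof.
have -> : frame_torus =
    \bigcup_(a in [set: 'rV[R]_m]) ((fun s : R => rotation (s *: a)) @` `[0, 1]%classic).
  apply/seteqP; split=> [t /frame_torus_rotation[a ha ->]|_ [a _ [s _ <-]]];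
    last exact: rotation_torus.
  by exists a => //; exists 1; rewrite ?scale1r //= in_itv /= lexx ler01.
apply: bigcup_connected => [|a _].
  by exists (rotation 0) => a _; exists 0; rewrite ?scale0r //= in_itv /= lexx ler01.
apply: connected_continuous_connected; first exact: segment_connected.
apply: continuous_subspaceT => s.
apply: (continuous_comp (f := fun s : R => s *: a) (g := rotation)).
  by apply: continuousZr_tmp.
exact: rotation_continuous.
Qed.

Lemma frame_torus_torus : torus frame_torus.
Proof.
have [uU _] := iU.
split; [| |exact: frame_torus_compact|exact: frame_torus_connected].
- split=> [|g h]; rewrite !inE.
    by exists (const_mx 1); rewrite /= map_mx1 mulmx1 diag_const_mx mul1mx.
  move=> [d gU] [e hU].
  have [ee hU'] := frame_tr (SO_orthogonal h) uU hU.
  exists (\row_j (d 0 j * (e 0 j)^*)) => /=.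
  rewrite map_mxM mulmxA gU -mulmxA -map_trmx hU' mulmxA; congr (_ *m _).
  by rewrite map_diag_mx mulmx_diag; congr diag_mx; apply/rowP => j; rewrite !mxE.
- move=> s t [d sU] [e tU]; apply: val_inj => /=.
  rewrite (transport_uniq nm iU (t := (s : 'M_n) *m (t : 'M_n)) erefl).
  rewrite [RHS](transport_uniq nm iU (t := (t : 'M_n) *m (s : 'M_n)) erefl); congr transport.
  rewrite !map_mxM !mulmxA sU tU -!mulmxA sU tU !mulmxA.
  by rewrite diag_mxC.
Qed.

End Torus.
End FrameTorus.

(** * Trace-preserving automorphisms of the special orthogonal group *)

Section SpanSO.
Variables (F : numFieldType) (n : nat).
Hypothesis n3 : (2 < n)%N.

(** Formal linear combinations of group elements are kept as lists, because the
map Sum c k |-> Sum c theta(k) is defined on them before it is known to depend only on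
the matrix Sum c k. *)
Definition lincomb (f : SO F n -> 'M[F]_n) (s : seq (F * SO F n)) : 'M[F]_n :=
  \sum_(x <- s) x.1 *: f x.2.

Definition SO_span (A : 'M[F]_n) := exists s, A = lincomb (@SO_val F n) s.

Lemma lincomb_cat f s1 s2 : lincomb f (s1 ++ s2) = lincomb f s1 + lincomb f s2.
Proof. exact: big_cat. Qed.

Definition lincomb_scale (a : F) (s : seq (F * SO F n)) := [seq (a * x.1, x.2) | x <- s].

Lemma lincomb_scaleE f a s : lincomb f (lincomb_scale a s) = a *: lincomb f s.
Proof.
by rewrite /lincomb big_map scaler_sumr; apply: eq_bigr => x _; rewrite scalerA.
Qed.

Definition lincomb_mulr (s : seq (F * SO F n)) (k : SO F n) := [seq (x.1, x.2 * k)%g | x <- s].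

Lemma lincomb_mulrE s k : lincomb (@SO_val F n) (lincomb_mulr s k) = lincomb (@SO_val F n) s *m k.
Proof.
by rewrite /lincomb big_map mulmx_suml; apply: eq_bigr => x _; rewrite -scalemxAl.
Qed.

Lemma SO_span_SO (k : SO F n) : SO_span k.
Proof. by exists [:: (1, k)]; rewrite /lincomb big_seq1 scale1r. Qed.

Lemma SO_spanD A B : SO_span A -> SO_span B -> SO_span (A + B).
Proof. by move=> [s ->] [t ->]; exists (s ++ t); rewrite lincomb_cat. Qed.

Lemma SO_spanZ a A : SO_span A -> SO_span (a *: A).
Proof. by move=> [s ->]; exists (lincomb_scale a s); rewrite lincomb_scaleE. Qed.

Lemma SO_spanMr A (k : SO F n) : SO_span A -> SO_span (A *m k).
Proof. by move=> [s ->]; exists (lincomb_mulr s k); rewrite lincomb_mulrE. Qed.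

Lemma mul_flip_special (A B : 'M[F]_n) : A^T *m A = 1%:M -> B^T *m B = 1%:M ->
  \det A = -1 -> \det B = -1 -> special_orthogonal (A *m B).
Proof.
move=> oA oB dA dB; rewrite /special_orthogonal det_mulmx dA dB mulrNN mulr1 eqxx andbT.
by rewrite trmx_mul -mulmxA (mulmxA A^T) oA mul1mx oB.
Qed.

Definition flip2 (a b : 'I_n) : SO F n :=
  MkSO (mul_flip_special (flip_mx_orthogonal F a) (flip_mx_orthogonal F b)
                         (det_flip_mx F a) (det_flip_mx F b)).

Lemma flip2E a b : a != b ->
  (flip2 a b : 'M_n) = 1%:M - 2%:R *: (delta_mx a a + delta_mx b b).
Proof.
move=> ab; rewrite /= /flip_mx mulmxBl mul1mx mulmxBr mulmx1 -scalemxAl -scalemxAr.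
rewrite mul_delta_mx_0 // !scaler0 subr0 scalerDr opprD addrA.
by rewrite addrAC.
Qed.

(** With D_ab the diagonal matrix having -1 exactly at a and b,
4 E_aa = 1 - D_ab - D_ac + D_bc. *)
Lemma SO_span_delta_diag (a : 'I_n) : SO_span (delta_mx a a).
Proof.
have [b /andP[ba _]] := third_index a a n3; have [c /andP[ca cb]] := third_index a b n3.
have -> : delta_mx a a = 4%:R^-1 *: ((1%g : SO F n) : 'M_n) +
   (- 4%:R^-1) *: (flip2 a b : 'M_n) + (- 4%:R^-1) *: (flip2 a c : 'M_n)
   + 4%:R^-1 *: (flip2 b c : 'M_n) :> 'M[F]_n.
  rewrite !flip2E 1?eq_sym //; apply/matrixP => i j; rewrite !mxE /=.
  by field.
have h x (k : SO F n) : SO_span (x *: (k : 'M_n)) by apply/SO_spanZ/SO_span_SO.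
exact: (SO_spanD (SO_spanD (SO_spanD (h _ _) (h _ _)) (h _ _)) (h _ _)).
Qed.

Lemma SO_span_all A : SO_span A.
Proof.
have dl a b : SO_span (delta_mx a b).
  have [->|ab] := eqVneq a b; first exact: SO_span_delta_diag.
  have [c /andP[ca cb]] := third_index a b n3.
  have op : (perm_mx (tperm a b) : 'M[F]_n)^T *m perm_mx (tperm a b) = 1%:M.
    by rewrite tr_perm_mx -perm_mxM mulVg perm_mx1.
  have dp : \det (perm_mx (tperm a b) : 'M[F]_n) = -1.
    by rewrite det_perm odd_tperm ab expr1.
  pose k := MkSO (mul_flip_special op (flip_mx_orthogonal F c) dp (det_flip_mx F c)).
  suff -> : delta_mx a b = delta_mx a a *m (k : 'M_n) :> 'M[F]_n.
    by apply: SO_spanMr; apply: SO_span_delta_diag.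
  rewrite /= mulmxA.
  have -> : delta_mx a a *m perm_mx (tperm a b) = delta_mx a b :> 'M[F]_n.
    rewrite -[tperm a b]tpermV -col_permE; apply/matrixP => i j; rewrite !mxE.
    by rewrite (canF_eq (tpermK a b)) tpermL.
  by rewrite /flip_mx mulmxBr mulmx1 -scalemxAr mul_delta_mx_0 1?eq_sym // scaler0 subr0.
have s0 : SO_span 0 by exists [::]; rewrite /lincomb big_nil.
rewrite (matrix_sum_delta A).
elim/big_ind: _ => [//||i _]; first exact: SO_spanD.
elim/big_ind: _ => [//||j _]; first exact: SO_spanD.
exact: SO_spanZ.
Qed.


Lemma SO_trace_nondegenerate (M : 'M[F]_n) :
  (forall k : SO F n, \tr (M *m k) = 0) -> M = 0.
Proof.
move=> h; apply/matrixP => i j; rewrite mxE.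
have <- : \tr (M *m delta_mx j i) = M i j.
  rewrite -(mul_delta_mx (0 : 'I_1)) mulmxA mxtrace_mulC -rowE -colE.
  by rewrite /mxtrace big_ord_recl big_ord0 addr0 !mxE.
have [s ->] := SO_span_all (delta_mx j i).
rewrite /lincomb mulmx_sumr raddf_sum big1 // => x _ /=.
by rewrite -scalemxAr linearZ /= h mulr0.
Qed.

Section Intertwiner.
Variable theta : SO F n -> SO F n.
Hypothesis thetaM : {morph theta : g h / (g * h)%g}.
Hypothesis thetaK : involutive theta.
Hypothesis theta_tr : forall k : SO F n, \tr (theta k : 'M_n) = \tr (k : 'M_n).

(** The trace form on the span of the group is nondegenerate, and [theta] preserves
the traces of all products, so that it preserves linear relations. *)
Lemma lincomb_theta_eq0 s : lincomb (@SO_val F n) s = 0 -> lincomb (fun k => theta k : 'M_n) s = 0.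
Proof.
move=> s0; apply: SO_trace_nondegenerate => l; rewrite -(thetaK l).
transitivity (\tr (lincomb (@SO_val F n) s *m theta l)); last by rewrite s0 mul0mx linear0.
rewrite /lincomb !mulmx_suml !raddf_sum; apply: eq_bigr => x _ /=.
rewrite -!scalemxAl !linearZ /=; congr (_ * _).
rewrite -[LHS]/(\tr ((theta x.2 * theta (theta l))%g : 'M_n)).
by rewrite -thetaM theta_tr.
Qed.

Lemma algebra_extension : exists Phi : 'M[F]_n -> 'M[F]_n,
  [/\ linear Phi, forall A (k : SO F n), Phi (A *m k) = Phi A *m theta k &
      forall A, \tr (Phi A) = \tr A].
Proof.
have [g hg] := boolp.choice SO_span_all.
pose Phi A := lincomb (fun k => theta k : 'M_n) (g A).
have PhiE s : Phi (lincomb (@SO_val F n) s) = lincomb (fun k => theta k : 'M_n) s.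
  apply/eqP; rewrite -subr_eq0 -scaleN1r -lincomb_scaleE -lincomb_cat; apply/eqP/lincomb_theta_eq0.
  by rewrite lincomb_cat lincomb_scaleE scaleN1r -hg subrr.
exists Phi; split.
- move=> a A B; rewrite [in LHS](hg A) [in LHS](hg B) -lincomb_scaleE -lincomb_cat PhiE.
  by rewrite lincomb_cat lincomb_scaleE.
- move=> A k; rewrite [in LHS](hg A) -lincomb_mulrE PhiE /lincomb big_map mulmx_suml.
  by apply: eq_bigr => x _; rewrite -scalemxAl /= thetaM.
- move=> A; rewrite [in RHS](hg A) /Phi /lincomb !raddf_sum; apply: eq_bigr => x _.
  by rewrite /= !mxtraceZ theta_tr.
Qed.

(** The Skolem-Noether argument: [Phi] makes the row space a module over the matrix
algebra, and a nonzero row of [Phi E_00] generates a copy of the standard module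
whose basis is formed by the rows of [P]. *)
Lemma intertwiner_exists : exists2 P : 'M[F]_n, P != 0 &
  forall k : SO F n, (k : 'M_n) *m P = P *m theta k.
Proof.
have [Phi [linP PhiM PhiT]] := algebra_extension.
pose PhiL := HB.pack_for {linear 'M[F]_n -> 'M[F]_n} Phi (GRing.isLinear.Build _ _ _ _ Phi linP).
pose i0 : 'I_n := Ordinal (ltn_trans (isT : 0 < 2)%N n3).
have [r r0] : exists r, row r (Phi (delta_mx i0 i0)) != 0.
  apply/existsP; apply: contraT; rewrite negb_exists => /forallP h.
  have E : Phi (delta_mx i0 i0) = 0.
    by apply/row_matrixP => r; rewrite row0; apply/eqP; have := h r; rewrite negbK.
  have := PhiT (delta_mx i0 i0); rewrite E linear0 -(mul_delta_mx (0 : 'I_1)).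
  rewrite mxtrace_mulC mul_delta_mx /mxtrace big_ord_recl big_ord0 !mxE eqxx addr0.
  by move/eqP; rewrite eq_sym oner_eq0.
exists (\matrix_j row r (Phi (delta_mx i0 j))).
  by apply: contra_neq r0 => P0; rewrite -(rowK (fun j => row r (Phi (delta_mx i0 j))) i0) P0 row0.
move=> k; apply/row_matrixP => i; rewrite !row_mul rowK mulmx_sum_row.
rewrite -row_mul -PhiM.
have -> : delta_mx i0 i *m (k : 'M_n) = \sum_j (k : 'M_n) i j *: delta_mx i0 j.
  apply/matrixP => a b; rewrite -(mul_delta_mx (0 : 'I_1)) -mulmxA -rowE mxE.
  rewrite big_ord_recl big_ord0 addr0 summxE.
  rewrite !mxE andbT (bigD1 b) //= big1 ?addr0 => [|j jb]; rewrite !mxE.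
    by rewrite eqxx andbT mulrC.
  by rewrite [b == j]eq_sym (negPf jb) andbF mulr0.
rewrite -[Phi _]/(PhiL _) !linear_sum; apply: eq_bigr => j _.
by rewrite rowK !linearZ /= mxE.
Qed.

End Intertwiner.
End SpanSO.

(** By Schur's lemma P P^T is a positive scalar, so that P can be rescaled to an
orthogonal matrix. *)
Lemma SO_conjugation (R : rcfType) n (theta : SO R n -> SO R n) : (2 < n)%N ->
  {morph theta : g h / (g * h)%g} -> involutive theta ->
  (forall k : SO R n, \tr (theta k : 'M_n) = \tr (k : 'M_n)) ->
  exists2 s : 'M[R]_n, s *m s^T = 1%:M &
    forall k : SO R n, (theta k : 'M_n) = s *m k *m s^T.
Proof.
move=> n3 thM thK thT; have [P P0 hP] := intertwiner_exists n3 thM thK thT.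
have th1 : theta 1%g = 1%g.
  by apply: (mulgI (theta 1%g)); rewrite -thM !mulg1.
have thV k : theta k^-1%g = (theta k)^-1%g.
  by apply: (mulgI (theta k)); rewrite -thM !mulgV.
have PTk (k : SO R n) : P^T *m (k : 'M_n) = (theta k : 'M_n) *m P^T.
  apply: trmx_inj; rewrite !trmx_mul !trmxK.
  by have := hP k^-1%g; rewrite thV.
have cP (k : SO R n) : P *m P^T *m (k : 'M_n) = (k : 'M_n) *m (P *m P^T).
  by rewrite -mulmxA PTk !mulmxA hP.
have /is_scalar_mxP[c PP] : is_scalar_mx (P *m P^T).
  apply: comm_skew_scalar => // X _; have [s ->] := SO_span_all n3 X.
  rewrite /lincomb mulmx_sumr mulmx_suml; apply: eq_bigr => x _.
  by rewrite -scalemxAl -scalemxAr cP.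
have PPE i : c = \sum_j P i j ^+ 2.
  have /matrixP/(_ i i) := PP; rewrite !mxE eqxx mulr1n => <-.
  by apply: eq_bigr => j _; rewrite mxE expr2.
have c0 : 0 < c.
  have i0 : 'I_n := Ordinal (ltn_trans (isT : 0 < 2)%N n3).
  rewrite lt_def [0 <= c](_ : _ = true) ?andbT; last first.
    by rewrite (PPE i0) sumr_ge0 // => j _; apply: sqr_ge0.
  apply: contra_neq P0 => c0; apply/matrixP => i j; rewrite mxE.
  have /eqP := PPE i; rewrite c0 eq_sym psumr_eq0 => [/allP h|? _]; last exact: sqr_ge0.
  by have := h j; rewrite mem_index_enum sqrf_eq0 => /(_ isT)/eqP.
have sc : Num.sqrt c ^+ 2 = c by rewrite sqr_sqrtr // ltW.
have sc0 : Num.sqrt c != 0 by rewrite sqrtr_eq0 -ltNge.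
have PP' : P^T *m P = c%:M.
  have cc : (c^-1 *: P) *m P^T = 1%:M.
    by rewrite -scalemxAl PP scale_scalar_mx mulVf // gt_eqF.
  have := mulmx1C cc; rewrite -scalemxAr => E.
  by rewrite -[LHS](scalerK (invr_neq0 (lt0r_neq0 c0))) E invrK scale_scalar_mx mulr1.
have inv2 : (Num.sqrt c)^-1 * (Num.sqrt c)^-1 = c^-1 by rewrite -invfM -expr2 sc.
exists ((Num.sqrt c)^-1 *: P^T).
  rewrite tr_scalemx trmxK -scalemxAl -scalemxAr PP' scalerA inv2.
  by rewrite scale_scalar_mx mulVf // gt_eqF.
move=> k; rewrite tr_scalemx trmxK -!scalemxAl -scalemxAr scalerA inv2 PTk -mulmxA PP'.
by rewrite mul_mx_scalar scalerA mulVf ?scale1r // gt_eqF.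
Qed.

(** * Weyl involutions are conjugations by reflections *)

Section Weyl.
Variable R : realType.
Local Notation C := R[i].
Local Notation rc := (real_complex R).
Local Notation "A %:CM" := (map_mx rc A) (at level 2, format "A %:CM").
Local Notation "A ^cj" := (map_mx (@Num.conj_op C) A) (at level 2, format "A ^cj").
Variables m n : nat.
Hypothesis nm : n = (m + m)%N.

(** A maximal torus has a frame, hence is contained in the torus of that frame, and
is equal to it by maximality. *)
Lemma maximal_torus_frame (T : set (SO R n)) : maximal_torus T ->
  exists2 U : 'M[C]_(m, n), isotropic U & T = frame_torus U.
Proof.
move=> [[[T1 TM] cT _ conT] maxT]; rewrite inE in T1.
pose S A := exists2 t : SO R n, T t & (t : 'M_n) = A.
have oS : orthogonal_family S.
  split=> [_ [t _ <-]|_ _ [s Ts <-] [t Tt <-]]; first exact: SO_orthogonal.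
  by have /(congr1 (@SO_val R n)) := cT s t Ts Tt.
have [v sv _ [t Tt <-]|U [uU iU hU]] := frame_of_fixing nm oS.
  exact: (connected_sign_row conT T1 sv).
exists U => //; symmetry; apply: maxT; first exact: frame_torus_torus.
by move=> t Tt; apply: hU; exists t.
Qed.

Lemma conjugate_into_frame_torus (U : 'M[C]_(m, n)) (k : SO R n) :
  odd m -> isotropic U -> exists g : SO R n, frame_torus U (g * k * g^-1)%g.
Proof.
move=> om iU.
have dk : \det (k : 'M_n) = 1 by apply/eqP; case/andP: (SO_valP k).
have [V [uV iV hV]] := frame_of_special nm (SO_orthogonal k) dk.
have [d kV] := hV _ erefl.
have iV' : isotropic V by [].
have step W e (iW : isotropic W) (kW : W *m (k : 'M_n)%:CM = diag_mx e *m W)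
    (sW : special_orthogonal (transport U W)) : exists g : SO R n, frame_torus U (g * k * g^-1)%g.
  exists (MkSO sW); exists e => /=; rewrite !map_mxM !mulmxA mulmx_transport // kW.
  rewrite -{1}(mulmx_transport W iU) -!mulmxA -map_mxM transport_orthogonal // map_mx1.
  by rewrite mulmx1.
have [|sV] := transport_special nm om iU iV'; first exact: step kV.
apply: (step _ (map_mx (@Num.conj_op C) d) (isotropic_conj iV')) => //.
by rewrite -{1}[(k : 'M_n)%:CM]conjmx_real -map_mxM kV map_mxM map_diag_mx.
Qed.

Variable theta : SO R n -> SO R n.
Hypothesis om : odd m.
Hypothesis htheta : Weyl_involution theta.

(** Up to conjugation k lies in the inverted torus, and k^-1 = k^T has the same
trace as k. *)
Lemma Weyl_trace (k : SO R n) : \tr (theta k : 'M_n) = \tr (k : 'M_n).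
Proof.
have [_ thM _ [T mT invT]] := htheta.
have [U iU TE] := maximal_torus_frame mT.
have [g gT] := conjugate_into_frame_torus k om iU.
rewrite -TE in gT; have E := invT _ gT.
transitivity (\tr (theta (g * k * g^-1)%g : 'M_n)).
  rewrite -{1}(mulKg g k) !thM -[RHS]mxtrace_mulC /=.
  by rewrite !mulmxA.
rewrite E /= mxtrace_tr mxtrace_mulC mulmxA.
by have /= -> := congr1 (@SO_val R n) (mulVg g); rewrite mul1mx.
Qed.

(** The element J of the torus that acts as i on the frame satisfies s J = J^T s, so
that [s] maps the i-eigenspace of J to its (-i)-eigenspace: in the basis formed by the
frame and its conjugate, [s] is antidiagonal with blocks A and conj A. *)
Lemma Weyl_reflection : (2 < n)%N -> exists s : 'M[R]_n, [/\ s *m s^T = 1%:M, \det s = -1 &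
  forall k : SO R n, (theta k : 'M_n) = s *m k *m s^T].
Proof.
move=> n3; have [_ thM thK [T mT invT]] := htheta.
have [s ss hs] := SO_conjugation n3 thM thK Weyl_trace.
exists s; split=> //.
have [U iU TE] := maximal_torus_frame mT.
pose d : 'rV[C]_m := const_mx 'i.
have dE : diag_mx d = 'i%:M by rewrite /d diag_const_mx.
have dd : diag_mx d *m (diag_mx d)^cj = 1%:M.
  by rewrite dE map_scalar_mx /= conjCi -scalar_mxM mulrN -expr2 sqrCi opprK.
pose J := MkSO (transport_diag_special nm iU dd).
have UJ : U *m (J : 'M_n)%:CM = 'i *: U by rewrite mulmx_transport // dE mul_scalar_mx.
have TJ : T J by rewrite TE; exists d; rewrite UJ dE mul_scalar_mx.
have sJ : s *m (J : 'M_n) = (J : 'M_n)^T *m s.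
  have := congr1 (@SO_val R n) (invT J TJ); rewrite hs /= => <-.
  by rewrite -!mulmxA (mulmx1C ss) mulmx1.
have [uU isoU] := iU.
have [_] := frame_tr (SO_orthogonal J) uU (mulmx_transport _ iU).
rewrite dE map_scalar_mx /= conjCi mul_scalar_mx => UJt.
have ci : (- 'i)^* = 'i :> C by rewrite rmorphN /= conjCi opprK.
have JU : (J : 'M_n)%:CM *m U^t* = 'i *: U^t*.
  have Jt : ((J : 'M_n)%:CM^T)^t* = (J : 'M_n)%:CM by rewrite trmxK conjmx_real.
  by rewrite -[X in X *m _]Jt -trmxC_mul UJt tr_scalemx conjmxZ ci.
pose Y := U *m s%:CM.
have YJ : Y *m (J : 'M_n)%:CM = - 'i *: Y.
  by rewrite /Y -mulmxA -map_mxM sJ map_mxM mulmxA -map_trmx UJt -scalemxAl.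
have YU : Y *m U^t* = 0.
  have : Y *m (J : 'M_n)%:CM *m U^t* = 'i *: (Y *m U^t*) by rewrite -mulmxA JU -scalemxAr.
  rewrite YJ -scalemxAl => /eqP; rewrite scaleNr eq_sym -addr_eq0 -mulr2n -scaler_nat scalerA.
  by rewrite scaler_eq0 mulf_eq0 pnatr_eq0 (negPf (neq0Ci _)) => /eqP.
pose A := Y *m U^T.
have YE : Y = A *m U^cj.
  by rewrite -[LHS]mulmx1 -(isotropic_complete nm iU) mulmxDr !mulmxA YU mul0mx add0r.
have Qs : with_conj U *m s%:CM = block_mx 0 A A^cj 0 *m with_conj U.
  rewrite /with_conj mul_col_mx mul_block_col !mul0mx addr0 add0r -/Y YE; congr col_mx.
  by rewrite -{1}[s%:CM]conjmx_real -map_mxM -/Y YE map_mxM conjmxK.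
have := det_intertwine (esym nm) (with_conj_unitary iU) Qs.
rewrite det_map_mx det_antidiag -signr_odd om expr1 det_map_mx mulN1r -normCK => ds.
have : \det s ^+ 2 == 1 by rewrite expr2 -{2}det_tr -det_mulmx ss det1.
rewrite sqrf_eq1 => /orP[] /eqP // s1; exfalso.
have := ltr01 (R := C); rewrite -(rmorph1 rc) -s1 ds oppr_gt0.
by move=> lt0; have := le_lt_trans (exprn_ge0 2 (normr_ge0 (\det A))) lt0; rewrite ltxx.
Qed.
End Weyl.

(** * The Killing form of the Lie algebra of size-five skew matrices *)

(** The trace computed from any family with coordinate functions, instead of the
abstract basis that is used in the definition of [endo_trace]. *)
Lemma endo_traceE (F : fieldType) (V : vectType F) (f : V -> V) N (X : 'I_N -> V)
    (xi : 'I_N -> V -> F) : linear f -> (forall p, scalar (xi p)) ->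
  (forall v, v = \sum_p xi p v *: X p) -> endo_trace f = \sum_p xi p (f (X p)).
Proof.
move=> lf lxi vE.
pose fL := HB.pack_for {linear V -> V} f (GRing.isLinear.Build _ _ _ _ f lf).
pose xiL p := HB.pack_for {scalar V} (xi p) (GRing.isLinear.Build _ _ _ _ (xi p) (lxi p)).
rewrite /endo_trace; set Y := vbasis _.
have YE v : v = \sum_i coord Y i v *: Y`_i by rewrite -coord_vbasis ?memvf.
transitivity (\sum_(i < \dim {:V}) \sum_p xi p (f Y`_i) * coord Y i (X p)).
  apply: eq_bigr => i _; rewrite {1}(vE (f _)) linear_sum.
  by apply: eq_bigr => p _; rewrite linearZ.
rewrite exchange_big; apply: eq_bigr => p _ /=.
rewrite [in RHS](YE (X p)) -[f _]/(fL _) linear_sum -[xi p _ in RHS]/(xiL p _) linear_sum.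
by apply: eq_bigr => i _; rewrite !linearZ /= mulrC.
Qed.

Section Killing.
Variable F : numFieldType.

Definition so_coord (x : so F 5) : 'cV[F]_10 := skew_coord (vsval x).

Lemma so_of_coord_subproof v : @skew_of_coord F v \in lker (linfun (@skew_defect F 5)).
Proof. exact/soP/skew_of_coord_tr. Qed.

Definition so_of_coord v : so F 5 := Subvs (so_of_coord_subproof v).

Lemma so_of_coordK : cancel so_of_coord so_coord.
Proof. by move=> v; rewrite /so_coord /= skew_of_coordK. Qed.

Lemma so_coordK : cancel so_coord so_of_coord.
Proof. by move=> x; apply: val_inj; rewrite /= skew_coordK ?tr_so. Qed.

Lemma so_coord_linear : linear so_coord.
Proof. by move=> a x y; apply/colP => p; rewrite !mxE. Qed.

Lemma so_coord_Ad (a : SO F 5) x : so_coord (Ad a x) = compound2 a *m so_coord x.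
Proof. by rewrite -skew_coord_conj ?tr_so. Qed.

Definition so_unit p : so F 5 := so_of_coord (delta_mx p 0).

Lemma so_unitE p : vsval (so_unit p) = skew_unit F (pair_fst p) (pair_snd p).
Proof.
rewrite -[RHS]skew_coordK ?tr_skew_unit //; congr skew_of_coord.
apply/colP => q; rewrite !mxE andbT.
have B : (pair_fst q == pair_snd p) && (pair_snd q == pair_fst p) = false.
  apply/negP => /andP[/eqP e1 /eqP e2].
  by have := pair_lt q; rewrite e1 e2 ltnNge (ltnW (pair_lt p)).
rewrite B subr0; congr (nat_of_bool _)%:R; have [->|qp] := eqVneq q p; first by rewrite !eqxx.
apply/esym; apply: contra_neqF qp => /andP[/eqP e1 /eqP e2].
by rewrite -[q]pair_fstK -[p]pair_fstK e1 e2.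
Qed.

Lemma so_expand x : x = \sum_p so_coord x p 0 *: so_unit p.
Proof.
rewrite -[LHS]so_coordK; apply: (can_inj so_coordK).
have -> : so_coord (\sum_p so_coord x p 0 *: so_unit p) =
    \sum_p so_coord x p 0 *: so_coord (so_unit p).
  pose L := HB.pack_for {linear so F 5 -> 'cV[F]_10} so_coord
    (GRing.isLinear.Build _ _ _ _ so_coord so_coord_linear).
  by rewrite -[so_coord _ in LHS]/(L _) linear_sum; apply: eq_bigr => p _; rewrite linearZ.
rewrite so_of_coordK [LHS]matrix_sum_delta; apply: eq_bigr => p _.
by rewrite big_ord1 so_of_coordK.
Qed.

Lemma mulmx_skew_unit n (A B : 'M[F]_n) i j :
  (A *m skew_unit F i j *m B) i j = A i i * B j j - A i j * B i j.
Proof.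
rewrite mulmxBr mulmxBl mxE [X in _ + X]mxE.
have E k l : (A *m delta_mx k l *m B) i j = A i k * B l j.
  rewrite -(mul_delta_mx (0 : 'I_1)) mulmxA -mulmxA -colE -rowE mxE big_ord1.
  by rewrite !mxE.
by rewrite !E.
Qed.

Lemma ad_linear (x : so F 5) : linear (ad x).
Proof.
move=> a y z; apply: val_inj; rewrite /= !linearP /= mulmxDl -scalemxAl scalerBr.
by rewrite opprD addrACA.
Qed.

(** With Q_ij = X_ij Y_ij, the diagonal coefficient of ad X ad Y at e_ij is
2 Q_ij minus the sums of rows i and j of Q. Summing over all i and j counts each
pair twice and the diagonal once. *)
Lemma killingE (x y : so F 5) :
  killing x y = - 6%:R * ((so_coord x)^T *m so_coord y) 0 0.
Proof.
pose X : 'M[F]_5 := vsval x; pose Y : 'M[F]_5 := vsval y.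
have sX : X^T = - X := tr_so x.
have sY : Y^T = - Y := tr_so y.
rewrite /killing (@endo_traceE _ _ _ _ so_unit (fun p z => so_coord z p 0)); last 3 first.
- by move=> a u v; rewrite /= !ad_linear.
- by move=> p a u v; rewrite so_coord_linear !mxE.
- exact: so_expand.
pose Q i j := X i j * Y i j; pose r i := \sum_j Q i j.
pose G i j := Q i j *+ 2 - r i - r j.
have QC i j : Q i j = Q j i.
  by rewrite /Q -[in RHS](trmxK X) -[in RHS](trmxK Y) sX sY !mxE mulrNN.
have XY i : (X *m Y) i i = - r i.
  rewrite mxE -sumrN; apply: eq_bigr => j _.
  by rewrite -[Y in LHS]trmxK sY !mxE mulrN.
have YX i : (Y *m X) i i = - r i.
  rewrite mxE -sumrN; apply: eq_bigr => j _.
  by rewrite -[X in LHS]trmxK sX !mxE mulrN mulrC.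
have brE (e : 'M[F]_5) : X *m (Y *m e - e *m Y) - (Y *m e - e *m Y) *m X =
    (X *m Y) *m e *m 1%:M - X *m e *m Y - Y *m e *m X + 1%:M *m e *m (Y *m X).
  by rewrite mulmxBr mulmxBl !mulmxA mulmx1 mul1mx opprB addrA addrAC.
transitivity (\sum_p G (pair_fst p) (pair_snd p)).
  apply: eq_bigr => p _; pose e := skew_unit F (pair_fst p) (pair_snd p).
  have -> : so_coord ((ad x \o ad y) (so_unit p)) =
      skew_coord (X *m (Y *m e - e *m Y) - (Y *m e - e *m Y) *m X).
    by rewrite /e -so_unitE.
  rewrite brE.
  have entry (A B C D : 'M[F]_5) i j : (A - B - C + D) i j = A i j - B i j - C i j + D i j.
    by rewrite !mxE.
  rewrite mxE entry !mulmx_skew_unit XY YX !(skew_diag0 _ sX) !(skew_diag0 _ sY).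
  have /negPf ne : pair_fst p != pair_snd p by rewrite -val_eqE ltn_eqF ?pair_lt.
  by rewrite /G /Q ![1%:M _ _]mxE !eqxx ne /=; ring.
have two0 : 2%:R != 0 :> F by rewrite pnatr_eq0.
have sumr : \sum_i r i = 2%:R * \sum_p Q (pair_fst p) (pair_snd p).
  rewrite /r sum_pairs big1 ?add0r => [|i _]; last by rewrite /Q (skew_diag0 _ sX) mul0r.
  by rewrite mulr_sumr; apply: eq_bigr => p _; rewrite [Q (pair_snd p) _]QC; ring.
have := sum_pairs G.
have -> : \sum_i G i i = - 2%:R * \sum_i r i.
  by rewrite mulr_sumr; apply: eq_bigr => i _; rewrite /G /Q (skew_diag0 _ sX) mul0r; ring.
have -> : \sum_p (G (pair_fst p) (pair_snd p) + G (pair_snd p) (pair_fst p)) =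
    2%:R * \sum_p G (pair_fst p) (pair_snd p).
  by rewrite mulr_sumr; apply: eq_bigr => p _; rewrite /G [Q (pair_snd p) _]QC; ring.
have -> : \sum_i \sum_j G i j = - 8%:R * \sum_i r i.
  rewrite /G; under eq_bigr => i _ do rewrite !sumrB sumrMnl sumr_const card_ord -/(r i).
  rewrite !sumrB sumrMnl sumr_const card_ord sumrMnl; ring.
rewrite sumr => E; have -> : \sum_p G (pair_fst p) (pair_snd p) =
    - 6%:R * \sum_p Q (pair_fst p) (pair_snd p).
  apply: (mulfI two0); apply: (addrI (- 2%:R * (2%:R * \sum_p Q (pair_fst p) (pair_snd p)))).
  by rewrite -E; ring.
congr (_ * _); rewrite mxE; apply: eq_bigr => p _.
by rewrite !mxE.
Qed.
End Killing.

(** * Equivariant maps of the homogeneous space *)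

Section Isometry.
Variable F : numClosedFieldType.
Variable phi : {linear so F 5 -> 'cV[F]_10}.
Hypothesis hphi : killing_isometry phi.

(** The scalar is a square root of -6, the value of the Killing form on the e_ij. *)
Lemma killing_isometryE : exists c (M : 'M[F]_10), [/\ c != 0, M^T *m M = 1%:M &
  forall x, phi x = c *: (M *m so_coord x)].
Proof.
pose A : 'M[F]_10 := \matrix_(i, p) phi (so_unit F p) i 0.
have phiE x : phi x = A *m so_coord x.
  rewrite {1}(so_expand x) linear_sum; apply/colP => i; rewrite summxE mxE.
  by apply: eq_bigr => p _; rewrite linearZ !mxE mulrC.
have AA : A^T *m A = (- 6%:R)%:M.
  apply/matrixP => p q; have := hphi.2 (so_unit F p) (so_unit F q).
  rewrite killingE !so_of_coordK !phiE !so_of_coordK => E.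
  transitivity (((A *m delta_mx p (0 : 'I_1))^T *m (A *m delta_mx q (0 : 'I_1))) 0 0).
    by rewrite trmx_mul -mulmxA (mulmxA A^T) -colE trmx_delta -rowE !mxE.
  rewrite E trmx_delta mul_delta_mx_cond !mxE.
  by case: eqP; rewrite ?mulr1n ?mulr0n ?mxE ?mulr1 ?mulr0.
pose c : F := sqrtC (- 6%:R).
have cc : c * c = - 6%:R by rewrite -expr2 sqrtCK.
have six0 : - 6%:R != 0 :> F by rewrite oppr_eq0 pnatr_eq0.
have c0 : c != 0 by rewrite sqrtC_eq0.
exists c, (c^-1 *: A); split=> // [|x].
  by rewrite tr_scalemx -scalemxAl -scalemxAr AA scalerA -invfM cc scale_scalar_mx mulVf.
by rewrite -scalemxAl scalerA divff // scale1r phiE.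
Qed.

End Isometry.

Section AdjointConjugate.
Variables (F : numFieldType) (phi : so F 5 -> 'cV[F]_10) (c : F) (M : 'M[F]_10).
Hypothesis c0 : c != 0.
Hypothesis phiE : forall x, phi x = c *: (M *m so_coord x).

Lemma adjoint_groupP (g : SO F 10) :
  reflect (exists a : SO F 5, (g : 'M_10) *m M = M *m compound2 (a : 'M_5))
          (g \in adjoint_group phi).
Proof.
apply: (iffP (asboolP _)) => -[a ga]; exists a.
  apply: matrix_mulv_eq => v; apply: (scalerI c0).
  have := ga (so_of_coord v); rewrite !phiE so_coord_Ad so_of_coordK.
  by rewrite -scalemxAr !mulmxA.
by move=> x; rewrite !phiE so_coord_Ad -scalemxAr !mulmxA ga.
Qed.
End AdjointConjugate.

Lemma compound2_special (F : rcfType) (a : SO F 5) :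
  compound2 (a : 'M_5) *m (compound2 (a : 'M_5))^T = 1%:M /\ \det (compound2 (a : 'M_5)) = 1.
Proof.
have /andP[/eqP oa /eqP da] := SO_valP a; split.
  by rewrite -compound2_tr -compound2M (mulmx1C oa) compound2_1.
apply: (@complexI F); rewrite -det_map_mx -compound2_map det_compound2 det_map_mx da.
by rewrite rmorph1 expr1n.
Qed.

Lemma orthogonal_mulmx (F : comNzRingType) n (A B : 'M[F]_n) :
  A *m A^T = 1%:M -> B *m B^T = 1%:M -> (A *m B) *m (A *m B)^T = 1%:M.
Proof. by move=> AA BB; rewrite trmx_mul mulmxA -(mulmxA A) BB mulmx1. Qed.

Lemma conj_mulmx4 (F : comNzRingType) n (A B S E L : 'M[F]_n) :
  A^T *m B^T *m S *m E *m L *m (A^T *m B^T *m S *m E)^T =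
  A^T *m (B^T *m (S *m (E *m L *m E^T) *m S^T *m B) *m A).
Proof. by rewrite !trmx_mul !trmxK !mulmxA. Qed.

Local Open Scope quotient_scope.

Lemma translate_fixP (G : groupType) (H : {pred G}) (Hgrp : group_closed H) (g b : G) :
  translate g (\pi_(coset_space Hgrp) b) = \pi_(coset_space Hgrp) b <-> (b^-1 * (g * b))%g \in H.
Proof.
rewrite translate_pi; split=> [E|E].
  have /(@eqmodP _ (coset_equiv Hgrp)) := esym E; exact.
by apply/esym/(@eqmodP _ (coset_equiv Hgrp)).
Qed.

Section Obstruction.
Variable R : realType.
Local Notation C := (Cplx R).
Local Notation rc := (real_complex R).

(** The point b H is fixed by the compact group formed by the matrices [k a]. *)
Lemma no_equivariant_map
    (phi : {linear so C 5 -> 'cV[C]_10}) (hphi : killing_isometry phi)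
    (theta : SO R 10 -> SO R 10) (htheta : Weyl_involution theta)
    (mu : coset_space (adjoint_group_closed phi) ->
          coset_space (adjoint_group_closed phi)) :
  ~ forall (k : SO R 10) x, mu (translate (complexify k) x) =
                            translate (complexify (theta k)) (mu x).
Proof.
move=> hmu.
have [c [M [c0 MM phiE]]] := killing_isometryE hphi.
have [s [ss ds hs]] : exists s : 'M[R]_10, [/\ s *m s^T = 1%:M, \det s = -1 &
    forall k : SO R 10, (theta k : 'M_10) = s *m k *m s^T].
  exact: (@Weyl_reflection R 5 10 erefl theta isT htheta isT).
have dsC : \det (map_mx rc s) = -1 by rewrite det_map_mx ds rmorphN rmorph1.
have MM' := mulmx1C MM.
have dM2 : \det M * \det M = 1 by rewrite -{1}det_tr -det_mulmx MM det1.
(* [M] may have determinant -1; a real E of the same determinant corrects it. *)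
have [E [EE dE]] : exists E : 'M[R]_10, E *m E^T = 1%:M /\ \det (map_mx rc E) = \det M.
  have /eqP : \det M ^+ 2 = 1 by rewrite expr2.
  rewrite sqrf_eq1 => /orP[] /eqP dM.
    by exists 1%:M; rewrite trmx1 mulmx1 map_mx1 det1 dM.
  by exists s; rewrite dsC dM.
have EEC : map_mx rc E *m (map_mx rc E)^T = 1%:M by rewrite map_trmx -map_mxM EE map_mx1.
have ssC : map_mx rc s *m (map_mx rc s)^T = 1%:M by rewrite map_trmx -map_mxM ss map_mx1.
have bP : special_orthogonal (map_mx rc E *m M^T : 'M[C]_10).
  rewrite /special_orthogonal trmx_mul trmxK -mulmxA (mulmxA _ (map_mx rc E)) (mulmx1C EEC).
  by rewrite mul1mx MM' eqxx det_mulmx dE det_tr dM2 eqxx.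
pose b : SO C 10 := MkSO bP.
have kP (a : SO R 5) : special_orthogonal (E *m compound2 (a : 'M_5) *m E^T).
  have [La dLa] := compound2_special a.
  rewrite /special_orthogonal; apply/andP; split; apply/eqP; last first.
    by rewrite !det_mulmx dLa mulr1 -det_mulmx EE det1.
  apply: mulmx1C; rewrite !trmx_mul trmxK !mulmxA -(mulmxA _ E^T) (mulmx1C EE).
  by rewrite mulmx1 -(mulmxA E) La mulmx1.
pose k a : SO R 10 := MkSO (kP a).
pose X := coset_space (adjoint_group_closed phi).
have fixb a : translate (complexify (k a)) (\pi_X b) = \pi_X b.
  apply/translate_fixP/(adjoint_groupP c0 phiE); exists (complexify a).
  rewrite /= compound2_map !map_mxM -map_trmx trmx_mul trmxK.
  by rewrite -!mulmxA !(mulmxA _^T (map_mx rc E)) (mulmx1C EEC) !mul1mx MM mulmx1.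
pose b' : SO C 10 := generic_quotient.repr (mu (\pi_X b)).
have b'E : mu (\pi_X b) = \pi_X b' by rewrite reprK.
pose B := (b' : 'M[C]_10).
have /andP[/eqP BB /eqP dB] : special_orthogonal B := SO_valP b'.
(* Left multiplication by [s] followed by a return to the base point: N
   normalizes the compound group and has determinant -1. *)
pose N : 'M[C]_10 := M^T *m B^T *m map_mx rc s *m map_mx rc E.
have NN : N *m N^T = 1%:M.
  do 3!apply: orthogonal_mulmx => //; rewrite trmxK //.
have dN : \det N = -1.
  rewrite !det_mulmx !det_tr dE dB dsC mulr1 mulrN1 mulNr.
  by rewrite dM2.
have : \det N = 1.
  apply: (normalizer_det1 (f := rc)) => // a oa da.
  have sa : special_orthogonal a by rewrite /special_orthogonal oa da !eqxx.
  have : translate (complexify (theta (k (MkSO sa)))) (\pi_X b') = \pi_X b'.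
    by rewrite -b'E -hmu fixb.
  move/translate_fixP/(adjoint_groupP c0 phiE) => [a' aE].
  have /andP[/eqP oa' _] := SO_valP a'.
  exists a' => //.
  have NE : N *m compound2 (map_mx rc a) *m N^T = compound2 a'.
    rewrite -[RHS]mul1mx -MM -[RHS]mulmxA -aE /= hs /= !map_mxM compound2_map.
    by rewrite /N conj_mulmx4 !map_trmx.
  by rewrite -NE -[RHS]mulmxA (mulmx1C NN) mulmx1.
rewrite dN => /eqP; rewrite eq_sym -addr_eq0 -mulr2n pnatr_eq0.
by [].
Qed.
End Obstruction.

Theorem proposition4 (R : realType)
    (phi : {linear so (Cplx R) 5 -> 'cV[Cplx R]_10})
    (hphi : killing_isometry phi)
    (theta : SO R 10 -> SO R 10) (htheta : Weyl_involution theta) :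
  ~ exists mu : coset_space (adjoint_group_closed phi) ->
                coset_space (adjoint_group_closed phi),
      [/\ antiholomorphic mu, involutive mu &
          forall (k : SO R 10) (x : coset_space (adjoint_group_closed phi)),
            mu (translate (complexify k) x) =
            translate (complexify (theta k)) (mu x)].
Proof.
by case=> mu [_ _ hmu]; exact: (no_equivariant_map hphi htheta hmu).
Qed.
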